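(* Let $(E,(P_t)_{t\ge 0},obs)$ be a CTMP and $0<c<1$. Let $\delta^c_0(x,y)=|obs(x)-obs(y)|$, $\delta^c_{n+1}=\mathcal{F}_c(\delta^c_n)$ and $\overline{\delta}^c=\sup_n\delta^c_n$. Then $\overline{\delta}^c$ is the least fixpoint of $\mathcal{F}_c$ (among pseudometrics in $\mathcal{P}$) that is greater than or equal to the pseudometric $(x,y)\mapsto|obs(x)-obs(y)|$: it is such a fixpoint, and every $m\in\mathcal{P}$ with $\mathcal{F}_c(m)=m$ and $m(x,y)\ge|obs(x)-obs(y)|$ for all $x,y$ satisfies $m\ge\overline{\delta}^c$ pointwise.
   Context: $E$ is a locally compact Hausdorff space with a countable base, equipped with its Borel $\sigma$-algebra; $E$ is Polish, with topology $\mathcal{O}$. $C_0(E)$ is the Banach space of continuous real functions vanishing at infinity. A CTMP consists of: a strongly continuous semigroup $(\hat P_t)_{t\ge 0}$ of bounded linear operators on $C_0(E)$ ($\hat P_0=I$, $\hat P_s\hat P_t=\hat P_{s+t}$) with $0\le f\le 1 \Rightarrow 0\le \hat P_t f\le 1$; associated Markov kernels $P_t$ with $\hat P_t f(x)=\int f(y)\,P_t(x,\mathrm{d}y)$, honest ($P_t(x,E)=1$; write $P_t(x)=P_t(x,\cdot)$); a continuous $obs:E\to[0,1]$; and weak continuity: $x_n\to x$ implies $P_t(x_n)\to P_t(x)$ weakly for every $t$. $\Gamma(\mu,\nu)$ is the set of couplings of probability measures $\mu,\nu$, and $W(m)(\mu,\nu)=\inf_{\gamma\in\Gamma(\mu,\nu)}\int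 m\,\mathrm{d}\gamma$ for lower semicontinuous $m:E\times E\to[0,1]$. $\mathcal{P}$ is the set of 1-bounded pseudometrics on $E$ lower semicontinuous w.r.t. $\mathcal{O}$, ordered pointwise. For $m\in\mathcal{P}$, $\mathcal{F}_c(m)(x,y)=\sup_{t\ge0}c^tW(m)(P_t(x),P_t(y))$. *)

(* Defs.v *)
From HB Require Import structures.
From mathcomp Require Import all_boot all_order all_algebra.
From mathcomp Require Import all_classical all_reals all_analysis.

Set Implicit Arguments.
Unset Strict Implicit.
Unset Printing Implicit Defensive.

Import Order.TTheory GRing.Theory Num.Theory.
Import numFieldNormedType.Exports.

Local Open Scope classical_set_scope.
Local Open Scope ring_scope.

Notation borel E := (g_sigma_algebraType (@open E)).

Definition polish (R : realType) (E : topologicalType) : Prop :=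
  (exists d : E -> E -> R,
    [/\ (forall x y, 0 <= d x y) /\ (forall x y, d x y = 0 <-> x = y),
        forall x y, d x y = d y x,
        forall x y z, d x z <= d x y + d y z,
        forall (x : E) (A : set E), nbhs x A <->
          exists2 e : R, 0 < e & [set y | d x y < e] `<=` A &
        forall u : nat -> E,
          (forall e : R, 0 < e -> exists N : nat, forall m n : nat,
            (N <= m)%N -> (N <= n)%N -> d (u m) (u n) < e) ->
          exists l : E, u @ \oo --> l]) /\
  (exists2 D : set E, countable D & dense D).

Section CTMP.
Context (R : realType) (E : ptopologicalType).

Definition vanishing_at_infinity (f : E -> R) : Prop :=
  forall e : R, 0 < e ->
    exists2 K : set E, compact K & forall x, ~ K x -> `|f x| < e.

Definition C0 : set (E -> R) :=
  [set f | continuous f /\ vanishing_at_infinity f].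

(* The norm of C0; elements of C0 are bounded, so this sup is a true one. *)
Definition supnorm (f : E -> R) : R := sup [set `|f x| | x in [set: E]].

Definition weak_cvg (mu_ : nat -> {measure set (borel E) -> \bar R})
    (mu : {measure set (borel E) -> \bar R}) : Prop :=
  forall f : E -> R, continuous f -> (exists M : R, forall x, `|f x| <= M) ->
    \int[mu_ n]_x f x @[n --> \oo] --> \int[mu]_x f x.

(* Times are reals; only the values of the semigroup and of the kernels at
   t >= 0, and those of the operators on C0, are meaningful. The kernels are
   honest because R.-pker is the type of probability kernels. *)
Record ctmp := CTMP {
  semigroup : R -> (E -> R) -> (E -> R) ;
  transition : R -> R.-pker (borel E) ~> (borel E) ;
  obs : E -> R ;
  semigroup_C0 : forall (t : R) f, 0 <= t -> C0 f -> C0 (semigroup t f) ;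
  semigroup_linear : forall (t a : R) f g, 0 <= t -> C0 f -> C0 g ->
    semigroup t (a \*: f \+ g) = a \*: semigroup t f \+ semigroup t g ;
  semigroup_bounded : forall t : R, 0 <= t -> exists M : R, forall f, C0 f ->
    supnorm (semigroup t f) <= M * supnorm f ;
  semigroup0 : forall f, C0 f -> semigroup 0 f = f ;
  semigroupD : forall (s t : R) f, 0 <= s -> 0 <= t -> C0 f ->
    semigroup s (semigroup t f) = semigroup (s + t) f ;
  semigroup_strong_cont : forall f, C0 f ->
    supnorm (semigroup t f \- f) @[t --> 0^'+] --> (0 : R) ;
  semigroup_markov : forall (t : R) f, 0 <= t -> C0 f ->
    (forall x, 0 <= f x <= 1) -> forall x, 0 <= semigroup t f x <= 1 ;
  transitionE : forall (t : R) f x, 0 <= t -> C0 f ->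
    semigroup t f x = \int[transition t x]_y f y ;
  obs_cont : continuous obs ;
  obs_bound : forall x, 0 <= obs x <= 1 ;
  transition_weak_cont : forall (t : R) (u : nat -> E) (x : E), 0 <= t ->
    u @ \oo --> x -> weak_cvg
      (fun n => transition t (u n)) (transition t x)
}.

(* A probability on the product sigma-algebra, which is the Borel
   sigma-algebra of E * E when E is second countable. *)
Definition coupling (mu nu : {measure set (borel E) -> \bar R}) :
    set (probability (borel E * borel E)%type R) :=
  [set gamma | forall A : set (borel E), measurable A ->
     gamma (A `*` setT) = mu A /\ gamma (setT `*` A) = nu A].

(* For probability measures mu, nu and measurable m : E * E -> [0, 1] the set
   below is a nonempty subset of [0, 1], so inf is a true infimum. *)
Definition W (m : E -> E -> R) (mu nu : {measure set (borel E) -> \bar R}) : R :=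
  inf [set \int[gamma]_z m z.1 z.2 | gamma in coupling mu nu].

Definition pseudometrics : set (E -> E -> R) :=
  [set m | [/\ forall x y, 0 <= m x y <= 1,
               forall x, m x x = 0,
               forall x y, m x y = m y x,
               forall x y z, m x z <= m x y + m y z &
               lower_semicontinuous (fun z : E * E => (m z.1 z.2)%:E)]].

Definition Fc (X : ctmp) (c : R) (m : E -> E -> R) : E -> E -> R :=
  fun x y => sup [set c `^ t * W m (transition X t x) (transition X t y)
                 | t in [set t : R | 0 <= t]].

Definition delta0 (X : ctmp) : E -> E -> R :=
  fun x y => `|obs X x - obs X y|.

Fixpoint delta (X : ctmp) (c : R) (n : nat) : E -> E -> R :=
  if n is n'.+1 then Fc X c (delta X c n') else delta0 X.

Definition delta_bar (X : ctmp) (c : R) : E -> E -> R :=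
  fun x y => sup (range (fun n => delta X c n x y)).

End CTMP.

(* Main.v *)
(** All the work is in the Kantorovich functional [W m] for a lower
    semicontinuous pseudometric [m].

    Compactness: from a tight sequence of laws one obtains a limit law by taking
    an ultrafilter limit on compact sets and extending this content to the Borel
    sets by Caratheodory's theorem. The limit [P] satisfies
    [P G <= lim P_n G] for open [G], hence [\int f dP <= lim \int f dP_n] for
    lower semicontinuous [f], by slicing [f] into its superlevel sets. Applied
    to couplings whose marginals converge weakly, this shows that [W m] is
    attained, that [(x, y) |-> W m (P_t x) (P_t y)] is lower semicontinuous, and that
    [W (sup m_n) = sup (W m_n)] for increasing [m_n].

    Triangle inequality: two couplings sharing the marginal [nu] are glued by
    conditional independence given a finite partition of the middle space; the
    limit along the partitions generated by a countable base is a law on [E^3]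
    under which the pointwise triangle inequality is integrated.

    Thus [Fc] preserves lower semicontinuous pseudometrics and commutes with
    increasing suprema; since [P_0 x] is the Dirac mass at [x], it is also
    inflationary, and the theorem is Kleene's fixpoint argument. *)

Require Import Defs.
From HB Require Import structures.
From mathcomp Require Import all_boot all_order all_algebra.
From mathcomp Require Import all_classical all_reals all_analysis.
From mathcomp Require Import measurable_realfun lra.
Import Order.TTheory GRing.Theory Num.Theory.
Import numFieldNormedType.Exports.
Local Open Scope classical_set_scope.
Local Open Scope ring_scope.

Set Implicit Arguments.
Unset Strict Implicit.
Unset Printing Implicit Defensive.

(** * Image laws as bundled probabilities *)

Lemma pushforward_probability d d' (S : measurableType d)
    (S' : measurableType d') (R : realType) (mu : {measure set S -> \bar R})
    (f : S -> S') : measurable_fun setT f -> mu setT = 1%E ->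
  exists P : probability S' R, P = pushforward mu f :> (set S' -> \bar R).
Proof.
move=> mf mu1.
pose F : {mfun S >-> S'} := HB.pack f (isMeasurableFun.Build _ _ _ _ _ mf).
(* [mnormalize] bundles a bare measure as a probability; its default, the Dirac mass, is never
   reached because the mass is one. *)
exists (distribution (mnormalize mu (dirac point)) F).
apply/funext => A; rewrite /distribution /pushforward /= /mnormalize mu1.
by rewrite onee_eq0/= invr1 mule1.
Qed.

(** * From a content on compact sets to a Borel probability *)

Section compact_content.
Local Open Scope ereal_scope.
Context (R : realType) (T : ptopologicalType) (alpha : set T -> R).
Hypotheses (T_hausdorff : hausdorff_space T) (T_regular : regular_space T).
Hypothesis alpha_le1 : forall K, compact K -> (alpha K <= 1)%R.
Hypothesis alpha_ge0 : forall K, compact K -> (0 <= alpha K)%R.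
Hypothesis le_alpha : forall K L, compact K -> compact L -> K `<=` L ->
  (alpha K <= alpha L)%R.
Hypothesis alphaU_le : forall K L, compact K -> compact L ->
  (alpha (K `|` L) <= alpha K + alpha L)%R.
Hypothesis alphaU_ge : forall K L, compact K -> compact L -> K `&` L = set0 ->
  (alpha K + alpha L <= alpha (K `|` L))%R.
Hypothesis alpha_tight : forall e : R, (0 < e)%R ->
  exists2 K, compact K & (1 - e <= alpha K)%R.

(** The classical two-step construction of a Radon measure: regularise from inside on open sets,
    then from outside on all sets. *)
Definition inner_content (G : set T) : \bar R :=
  ereal_sup [set (alpha K)%:E | K in [set K | compact K /\ K `<=` G]].

Definition outer_content (A : set T) : \bar R :=
  ereal_inf [set inner_content G | G in [set G | open G /\ A `<=` G]].

Lemma compact_content0 : alpha set0 = 0%R.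
Proof.
apply/eqP; rewrite eq_le alpha_ge0 ?andbT; last exact: compact0.
have := alphaU_ge (@compact0 T) (@compact0 T) (setI0 _).
by rewrite setU0 gerDl.
Qed.

Lemma inner_content_ge0 G : 0 <= inner_content G.
Proof.
apply: ereal_sup_ubound; exists set0; rewrite ?compact_content0//=.
by split; [exact: compact0|exact: sub0set].
Qed.

Lemma inner_content_le1 G : inner_content G <= 1.
Proof. by apply: ge_ereal_sup => _ [K [cK _] <-]; rewrite lee_fin alpha_le1. Qed.

Lemma le_inner_content G H : G `<=` H -> inner_content G <= inner_content H.
Proof.
move=> GH; apply: ge_ereal_sup => _ [K [cK KG] <-].
by apply: ereal_sup_ubound; exists K => //; split => //; exact: subset_trans GH.
Qed.

Lemma compact_content_bigU (H : nat -> set T) n : (forall i, compact (H i)) ->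
  (alpha (\big[setU/set0]_(i < n) H i) <= \sum_(i < n) alpha (H i))%R.
Proof.
move=> cH; elim: n => [|n IH]; first by rewrite !big_ord0 compact_content0.
rewrite !big_ord_recr/= (le_trans (alphaU_le _ _))//.
- exact: bigsetU_compact.
- by rewrite lerD2r.
Qed.

(** By regularity each point of [K] has a closed neighbourhood inside some [G i]. Finitely many of
    these cover [K], and grouping their traces on [K] by the index [i] gives the compact pieces. *)
Lemma compact_cover_split (K : set T) (G : nat -> set T) :
  compact K -> (forall n, open (G n)) -> K `<=` \bigcup_n G n ->
  exists N (H : nat -> set T), [/\ forall i, compact (H i),
    forall i, H i `<=` G i & K `<=` \big[setU/set0]_(i < N) H i].
Proof.
move=> cK oG KG.
have /choice[f fP] : forall x, exists p : nat * set T, K x ->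
    [/\ closed p.2, p.2 `<=` G p.1 & nbhs x p.2].
  move=> x; have [Kx|nKx] := pselect (K x); last by exists (0%N, set0).
  have [n _ Gnx] := KG _ Kx.
  have [C xC CG] := @T_regular x (G n) (open_nbhs_nbhs (conj (oG n) Gnx)).
  exists (n, closure C) => _; split => //=; first exact: closed_closure.
  by apply: filterS xC; exact: subset_closure.
have : cover_compact K by rewrite -compact_cover.
move=> /(_ T K (fun x => (f x).2°)); case.
- by move=> x _; exact: open_interior.
- by move=> x Kx; exists x => //; have [_ _] := fP x Kx.
move=> D DK KD.
pose H i := \big[setU/set0]_(x <- finmap.enum_fset D | (f x).1 == i) (K `&` (f x).2).
(* One more than the largest index used by the finite subcover. *)
exists (\max_(x <- finmap.enum_fset D) (f x).1).+1, H; split.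
- move=> i; rewrite /H big_seq_cond; apply: bigsetU_compact => x /andP[xD _].
  have /fP[clC _ _] : K x by have := DK x xD; rewrite inE.
  exact: compact_closedI.
- move=> i y; rewrite /H -bigcup_seq_cond => -[x /= /andP[xD /eqP <-]] [_].
  have /fP[_ sub _] : K x by have := DK x xD; rewrite inE.
  exact: sub.
- move=> y Ky; have [x /= xD xy] := KD _ Ky.
  rewrite -bigcup_mkord; exists (f x).1.
    by rewrite /= ltnS (leq_bigmax_seq x).
  rewrite /H -bigcup_seq_cond; exists x => /=; first by rewrite eqxx andbT.
  by split => //; exact: interior_subset.
Qed.

Lemma inner_content_bigcup (G : nat -> set T) : (forall n, open (G n)) ->
  inner_content (\bigcup_n G n) <= \sum_(n <oo) inner_content (G n).
Proof.
move=> oG; apply: ge_ereal_sup => _ [K [cK KG] <-].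
have [N [H [cH HG KH]]] := compact_cover_split cK oG KG.
apply: (@le_trans _ _ (\sum_(i < N) inner_content (G i))).
  apply: (@le_trans _ _ (\sum_(i < N) (alpha (H i))%:E)).
    rewrite sumEFin lee_fin (le_trans _ (compact_content_bigU N cH))//.
    by apply: le_alpha => //; exact: bigsetU_compact.
  apply: lee_sum => i _; apply: ereal_sup_ubound.
  by exists (H i); rewrite /= ?cH//; split => //; exact: HG.
rewrite -(big_mkord xpredT (fun i => inner_content (G i))).
by apply: nneseries_lim_ge => n _ _; exact: inner_content_ge0.
Qed.

Lemma outer_content_ge0 A : 0 <= outer_content A.
Proof.
by apply: le_ereal_inf_tmp => _ [G _ <-]; exact: inner_content_ge0.
Qed.

Lemma outer_content_le A G : open G -> A `<=` G ->
  outer_content A <= inner_content G.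
Proof. by move=> oG AG; apply: ereal_inf_lbound; exists G. Qed.

Lemma outer_content_fin_num A : outer_content A \is a fin_num.
Proof.
rewrite ge0_fin_numE ?outer_content_ge0//.
rewrite (le_lt_trans (outer_content_le openT (@subsetT _ A)))//.
by rewrite (le_lt_trans (inner_content_le1 _))// ltry.
Qed.

Lemma outer_content_open G : open G -> outer_content G = inner_content G.
Proof.
move=> oG; apply/eqP; rewrite eq_le outer_content_le//=.
by apply: le_ereal_inf_tmp => _ [H [_ GH] <-]; exact: le_inner_content.
Qed.

Lemma le_outer_content A B : A `<=` B -> outer_content A <= outer_content B.
Proof.
move=> AB; apply: le_ereal_inf_tmp => _ [G [oG BG] <-].
by apply: outer_content_le => //; exact: subset_trans BG.
Qed.

Lemma outer_content0 : outer_content set0 = 0.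
Proof.
rewrite outer_content_open; last exact: open0.
apply/eqP; rewrite eq_le inner_content_ge0 andbT.
apply: ge_ereal_sup => _ [K [_ K0] <-].
by move: K0; rewrite subset0 => ->; rewrite compact_content0.
Qed.

Lemma outer_content_sigma_subadditive : sigma_subadditive outer_content.
Proof.
move=> A; apply/lee_addgt0Pr => e e0.
rewrite (le_trans _ (epsilon_trick _ _ (ltW e0)))//; last first.
  by move=> n; exact: outer_content_ge0.
have /choice[G GP] : forall n, exists G, [/\ open G, A n `<=` G &
    inner_content G <= outer_content (A n) + (e / (2 ^ n.+1)%:R)%:E].
  move=> n; have en : (0 < e / (2 ^ n.+1)%:R)%R.
    by rewrite divr_gt0// ltr0n expn_gt0.
  have := lb_ereal_inf_adherent en (outer_content_fin_num (A n)).
  by move=> [_ [G [oG AG] <-] /ltW]; exists G.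
apply: (@le_trans _ _ (inner_content (\bigcup_n G n))).
  apply: outer_content_le.
  - by apply: bigcup_open => n _; have [] := GP n.
  - by apply: subset_bigcup => n _; have [] := GP n.
apply: (le_trans (inner_content_bigcup _)) => [n|]; first by have [] := GP n.
apply: lee_nneseries => [n _ _|n _]; first exact: inner_content_ge0.
by have [] := GP n.
Qed.

(** Inside an open [G] containing [X], take a compact [H1] in [G] and [O], then a compact [H0] in
    [G] minus [H1]. They are disjoint, so superadditivity bounds the sum of their contents by that
    of [G]; suprema over [H0], then over [H1], give the claim. *)
Lemma outer_content_caratheodory O : open O -> forall X,
  outer_content (X `&` O) + outer_content (X `&` ~` O) <= outer_content X.
Proof.
move=> oO X; apply: le_ereal_inf_tmp => _ [G [oG XG] <-].
apply: (@le_trans _ _ (outer_content (G `&` O) + outer_content (G `&` ~` O))).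
  by apply: leeD; apply: le_outer_content; exact: setSI.
rewrite outer_content_open; last exact: openI.
rewrite -leeBrDr ?outer_content_fin_num//.
apply: ge_ereal_sup => _ [H1 [cH1 H1GO] <-].
rewrite leeBrDr ?outer_content_fin_num//.
have oH1 : open (~` H1) by apply: closed_openC; exact: compact_closed.
(* The complement of [H1] is open and contains that of [O], so the outer content of the second piece
   is bounded by an inner content. *)
apply: (@le_trans _ _ ((alpha H1)%:E + inner_content (G `&` ~` H1))).
  rewrite leeD2l// outer_content_le//; first exact: openI.
  by move=> x [Gx nOx]; split => // /H1GO[].
rewrite addeC -leeBrDr//; apply: ge_ereal_sup => _ [H0 [cH0 H0G] <-].
rewrite leeBrDr// -EFinD; apply: (@le_trans _ _ (alpha (H0 `|` H1))%:E).
  rewrite lee_fin alphaU_ge//; apply/seteqP; split => // x [/H0G[_]].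
  by [].
apply: ereal_sup_ubound; exists (H0 `|` H1) => //; split.
  exact: compactU.
by move=> x [/H0G[]//|/H1GO[]].
Qed.

(** Open sets are Caratheodory measurable, hence so are Borel sets, and tightness makes the total
    mass one. *)
Theorem compact_content_extension :
  exists P : probability (borel T) R,
    forall G, open G -> P G = inner_content G.
Proof.
pose mu : {outer_measure set T -> \bar R} := HB.pack outer_content
  (isOuterMeasure.Build R T outer_content outer_content0 outer_content_ge0
     le_outer_content outer_content_sigma_subadditive).
pose U := caratheodory_type mu.
(* Measurability of the identity says that Borel sets are Caratheodory measurable; the law is then
   the image under this map. *)
have mid : measurable_fun setT (id : U -> borel T).
  move=> _ A mA; rewrite setTI preimage_id.
  apply: (@smallest_sub _ (sigma_algebra setT) (@open T)
    (measurable : set (set U))) mA.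
    exact: (@sigma_algebra_measurable _ U).
  move=> O oO; apply: (@le_caratheodory_measurable _ _ mu) => X.
  exact: outer_content_caratheodory.
have mu1 : (mu : {measure set U -> \bar R}) setT = 1.
  rewrite /= outer_content_open; last exact: openT.
  apply/eqP; rewrite eq_le inner_content_le1/=.
  apply/lee_addgt0Pr => e e0; have [K cK Ke] := alpha_tight e0.
  apply: (@le_trans _ _ ((alpha K)%:E + e%:E)).
    by rewrite -EFinD lee_fin -lerBlDr.
  by rewrite leeD2r//; apply: ereal_sup_ubound; exists K.
have [P PE] := pushforward_probability mid mu1.
by exists P => G oG; rewrite PE /pushforward preimage_id /= outer_content_open.
Qed.

End compact_content.

(** * Superlevel sets and integrals of bounded functions *)

Section real_valued_measurability.
Context d (S : measurableType d) (R : realType).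

Lemma measurable_fun_superlevel (f : S -> R) :
  (forall a, measurable [set x | a < f x]) -> measurable_fun setT f.
Proof.
move=> mf; apply: (measurability _ (RGenOInfty.measurableE R)) => //.
by move=> _ [_ [a ->] <-]; rewrite setTI preimage_itvoy.
Qed.

Lemma measurable_superlevel (f : S -> R) a : measurable_fun setT f ->
  measurable [set x | a < f x].
Proof.
move=> mf; rewrite -[X in measurable X]setTI.
by rewrite -preimage_itvoy; exact: mf.
Qed.

Lemma lsc_superlevel_open (T : topologicalType) (f : T -> R) a :
  lower_semicontinuous (EFin \o f) -> open [set x | a < f x].
Proof. by move=> /lower_semicontinuousP/(_ a). Qed.

End real_valued_measurability.

Section bounded_integrals.
Context d (S : measurableType d) (R : realType) (P : probability S R).

Lemma bounded_integrable (f : S -> R) (M : R) : measurable_fun setT f ->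
  (forall x, `|f x| <= M) -> P.-integrable setT (EFin \o f).
Proof.
move=> mf fM; apply: measurable_bounded_integrable => //.
  by rewrite [ltLHS]probability_setT ltry.
exists M; split; first exact: num_real.
by move=> r Mr x _; exact: le_trans (fM x) (ltW Mr).
Qed.

Lemma unit_integrable (f : S -> R) : measurable_fun setT f ->
  (forall x, 0 <= f x <= 1) -> P.-integrable setT (EFin \o f).
Proof.
move=> mf f01; apply: (@bounded_integrable _ 1) => // x.
by have /andP[f0 f1] := f01 x; rewrite ger0_norm.
Qed.

Lemma Rintegral_indic (A : set S) : measurable A ->
  \int[P]_x \1_A x = fine (P A).
Proof. by move=> mA; rewrite /Rintegral integral_indic// setIT. Qed.

Lemma indic_integrable (A : set S) : measurable A ->
  P.-integrable setT (EFin \o (\1_A : S -> R)).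
Proof.
move=> mA; apply: unit_integrable; first exact: measurable_indic.
by move=> x; rewrite indicE ler0n lern1 leq_b1.
Qed.

Lemma Rintegral_sum_indic (A : nat -> set S) n : (forall i, measurable (A i)) ->
  P.-integrable setT (EFin \o (fun x => \sum_(i < n) (\1_(A i) x : R))) /\
  \int[P]_x (\sum_(i < n) \1_(A i) x) = \sum_(i < n) fine (P (A i)).
Proof.
move=> mA; elim: n => [|n [IH1 IH2]].
  rewrite (_ : (fun x => _) = cst 0)//; last first.
    by apply/funext => x; rewrite big_ord0.
  rewrite Rintegral_cst// mul0r big_ord0; split => //.
  by apply: unit_integrable => // x; rewrite lexx ler01.
rewrite big_ord_recr/= -IH2 -Rintegral_indic// -RintegralD//; last first.
  exact: indic_integrable.
rewrite (_ : (fun x => \sum_(i < n.+1) _) =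
    (fun x => \sum_(i < n) \1_(A i) x + (\1_(A n) x : R))); last first.
  by apply/funext => x; rewrite big_ord_recr.
by split => //; exact: (integrableD measurableT IH1 (indic_integrable (mA n))).
Qed.

End bounded_integrals.

(** * Discrete layer-cake estimates *)

Section layer_cake.
Context (R : realType).

(** The sum counts the integers from 1 to [n] strictly below [y]. With the next lemma, this count
    lies between [y - 1] and [y] when [0 <= y <= n]. *)
Lemma sum_lt_nat_le (y : R) n : 0 <= y ->
  \sum_(i < n) (i.+1%:R < y)%R%:R <= y.
Proof.
move=> y0; elim: n => [|n IH]; first by rewrite big_ord0.
rewrite big_ord_recr/=; have [ny|yn] := ltP n.+1%:R y; last by rewrite addr0.
apply: le_trans (ltW ny); rewrite -natr1 lerD2r.
rewrite (@le_trans _ _ (\sum_(i < n) 1))//; last by rewrite sumr_const card_ord.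
by apply: ler_sum => i _; rewrite lern1 leq_b1.
Qed.

Lemma le_sum_lt_nat (y : R) n : y <= n%:R ->
  y <= 1 + \sum_(i < n) (i.+1%:R < y)%R%:R.
Proof.
elim: n => [|n IH] yn; first by rewrite big_ord0 addr0 (le_trans yn).
have [yn'|ny] := leP y n%:R.
  by rewrite big_ord_recr/= (le_trans (IH yn'))// addrA lerDl ler0n.
rewrite big_ord_recr/= (le_trans yn)// -natr1 [leLHS]addrC lerD2l.
rewrite (@le_trans _ _ (\sum_(i < n) 1))//; first by rewrite sumr_const card_ord.
rewrite -[leLHS]addr0 lerD ?ler0n// ler_sum// => i _.
by rewrite (le_lt_trans _ ny)// ler_nat.
Qed.

Context d (S : measurableType d) (P : probability S R).
Variables (f : S -> R) (n : nat).
Hypotheses (mf : measurable_fun setT f) (f01 : forall x, 0 <= f x <= 1).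
Let A (i : nat) := [set x | i.+1%:R / n.+1%:R < f x].

Let mA i : measurable (A i).
Proof. exact: measurable_superlevel. Qed.

Let indicA x (i : nat) : \1_(A i) x = (i.+1%:R < n.+1%:R * f x)%R%:R :> R.
Proof.
rewrite indicE /A; congr (nat_of_bool _)%:R.
by apply/idP/idP; rewrite ?inE /= ltr_pdivrMr ?ltr0n// mulrC// => h; rewrite inE.
Qed.

(** The counting bound at [y = n.+1%:R * f x], integrated in [x]. Together with [layer_cake_ge], it
    recovers the integral from the masses of superlevel sets up to an error [1 / n.+1]. *)
Lemma layer_cake_le :
  \sum_(i < n.+1) fine (P (A i)) <= n.+1%:R * \int[P]_x f x.
Proof.
have [iA <-] := Rintegral_sum_indic P n.+1 mA.
have fi : P.-integrable setT (EFin \o f) by exact: unit_integrable.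
rewrite -RintegralZl//; apply: le_Rintegral => //.
  by apply: (integrableZl measurableT n.+1%:R) fi.
move=> x _; under eq_bigr do rewrite indicA; rewrite sum_lt_nat_le//.
by rewrite mulr_ge0//; case/andP: (f01 x).
Qed.

Lemma layer_cake_ge :
  n.+1%:R * \int[P]_x f x <= 1 + \sum_(i < n.+1) fine (P (A i)).
Proof.
have [iA <-] := Rintegral_sum_indic P n.+1 mA.
have fi : P.-integrable setT (EFin \o f) by exact: unit_integrable.
have c1 : P.-integrable setT (EFin \o (cst 1 : S -> R)).
  by apply: unit_integrable => // x; rewrite lexx ler01.
have i1 : \int[P]_x (cst 1 x : R) = 1.
  by rewrite Rintegral_cst// mul1r [X in fine X]probability_setT.
rewrite -[X in X + _]i1 -RintegralZl// -RintegralD//; apply: le_Rintegral => //.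
- by apply: (integrableZl measurableT n.+1%:R) fi.
- exact: (integrableD measurableT c1 iA).
move=> x _; under eq_bigr do rewrite indicA; rewrite le_sum_lt_nat//.
by rewrite -[leRHS]mulr1 ler_wpM2l//; case/andP: (f01 x).
Qed.

End layer_cake.

(** * Limits of tight sequences of laws *)

(** Compactness of the unit interval gives a cluster point, and an ultrafilter converges to each of
    its cluster points. *)
Lemma ultrafilter_unit_cvg (R : realType) (I : Type) (U : set_system I)
    (u : I -> R) : UltraFilter U -> (forall n, 0 <= u n <= 1) -> cvg (u @ U).
Proof.
move=> UU u01; have PF : ProperFilter (u @ U) by exact: fmap_proper_filter.
have [|p [_ pU]] := @segment_compact R 0 1 (u @ U).
  by apply: (filterE (F := U)) => n; rewrite /= in_itv/=; exact: u01.
apply/cvg_ex; exists p => V Vp.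
have [//|nV] := in_ultra_setVsetC (u @^-1` V) UU.
by have [y [/= nVy Vy]] := pU (~` V) V nV Vp.
Qed.

Section weak_limit.
Context (R : realType) (T : ptopologicalType) d (S : measurableType d).
Variables (i : S -> T) (P_ : nat -> probability S R).
Hypotheses (T_hausdorff : hausdorff_space T) (T_regular : regular_space T).
Hypothesis open_preimage_measurable :
  forall G, open G -> measurable (i @^-1` G).
Hypothesis tight : forall e : R, 0 < e -> exists2 K, compact K &
  \forall n \near \oo, 1 - e <= fine (P_ n (i @^-1` K)).

(** The laws live on [S] and are seen in [T] through [i], so that [S] may carry a product
    sigma-algebra while [T] carries the product topology. *)
Let compact_preimage_measurable K : compact K -> measurable (i @^-1` K).
Proof.
move=> cK; rewrite -(setCK K) -preimage_setC; apply: measurableC.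
by apply: open_preimage_measurable; apply: closed_openC; apply: compact_closed.
Qed.

Lemma fine_probability01 d' (S' : measurableType d') (P : probability S' R) A :
  measurable A -> 0 <= fine (P A) <= 1.
Proof.
move=> mA; rewrite fine_ge0//= -lee_fin fineK ?fin_num_measure//.
exact: probability_le1.
Qed.

(* The compact content is the limit of the [P_ n] along an ultrafilter, so no
   subsequence has to be extracted. *)
Theorem prokhorov : exists P : probability (borel T) R,
  forall f : T -> R, (forall x, 0 <= f x <= 1) ->
    lower_semicontinuous (EFin \o f) ->
    forall a, (\forall n \near \oo, \int[P_ n]_s f (i s) <= a) ->
    \int[P]_x f x <= a.
Proof.
(* [U] refines [\oo], so whatever holds eventually holds along [U]. *)
have [U [UU sU]] := ultraFilterLemma (_ : ProperFilter \oo).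
pose u A n := fine (P_ n (i @^-1` A)).
pose alpha A := lim (u A @ U).
have u01 A : measurable (i @^-1` A) -> forall n, 0 <= u A n <= 1.
  by move=> mA n; exact: fine_probability01.
have ucvg A : measurable (i @^-1` A) -> cvg (u A @ U).
  by move=> mA; apply: ultrafilter_unit_cvg; exact: u01.
have mono A B : measurable (i @^-1` A) -> measurable (i @^-1` B) -> A `<=` B ->
    alpha A <= alpha B.
  move=> mA mB AB; apply: ler_lim; [exact: ucvg|exact: ucvg|].
  apply: filterE => n; rewrite /u fine_le ?fin_num_measure//.
  by rewrite le_measure ?inE//; exact: preimage_subset.
have alphaD A B : measurable (i @^-1` A) -> measurable (i @^-1` B) ->
    alpha A + alpha B = lim ((u A + u B) @ U).
  by move=> mA mB; rewrite limD//; exact: ucvg.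
have cm := compact_preimage_measurable.
have [|||||e e0|P PE] := @compact_content_extension R T alpha T_hausdorff T_regular.
- move=> K cK; apply: limr_le; first exact: ucvg (cm _ cK).
  by apply: filterE => n; case/andP: (u01 _ (cm _ cK) n).
- move=> K cK; apply: limr_ge; first exact: ucvg (cm _ cK).
  by apply: filterE => n; case/andP: (u01 _ (cm _ cK) n).
- by move=> K L cK cL; apply: mono; exact: cm.
- move=> K L cK cL; rewrite alphaD; [|exact: cm|exact: cm].
  have mU : measurable (i @^-1` (K `|` L)) by apply: cm; exact: compactU.
  apply: ler_lim; [exact: ucvg|apply: is_cvgD; apply: ucvg; exact: cm|].
  apply: filterE => n; rewrite /u fctE -fineD ?fin_num_measure//; try exact: cm.
  rewrite fine_le ?fin_num_measure ?fin_numD ?fin_num_measure//; try exact: cm.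
  by rewrite preimage_setU; apply: measureU2; exact: cm.
- move=> K L cK cL KL0; rewrite alphaD; [|exact: cm|exact: cm].
  have mU : measurable (i @^-1` (K `|` L)) by apply: cm; exact: compactU.
  apply: ler_lim; [apply: is_cvgD; apply: ucvg; exact: cm|exact: ucvg|].
  apply: filterE => n; rewrite /u fctE -fineD ?fin_num_measure//; try exact: cm.
  rewrite preimage_setU measureU//; [exact: cm|exact: cm|].
  by rewrite -preimage_setI KL0 preimage_set0.
- have [K cK Ke] := tight e0; exists K => //.
  by apply: limr_ge; [exact: ucvg (cm _ cK)|exact: sU].
exists P => f f01 lscf a fa.
have openA b : open [set x | b < f x] by exact: lsc_superlevel_open.
have mf : measurable_fun setT (f : borel T -> R).
  by apply: measurable_fun_superlevel => b; exact: sub_sigma_algebra.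
have mfi : measurable_fun setT (f \o i).
  apply: measurable_fun_superlevel => b.
  exact: (open_preimage_measurable (openA b)).
(* The portmanteau inequality on open sets: [P G] is a supremum of contents of compact subsets of
   [G]. *)
have P_alpha G : open G -> fine (P G) <= alpha G.
  move=> oG; rewrite -lee_fin fineK; last first.
    by apply: fin_num_measure; exact: sub_sigma_algebra.
  rewrite PE//; apply: ge_ereal_sup => _ [K [cK KG] <-].
  by rewrite lee_fin; apply: mono => //; [exact: cm|exact: open_preimage_measurable].
apply/ler_addgt0Pr => e e0.
have [n ne] : exists n, n.+1%:R^-1 < e.
  have [n _ ne] := near_infty_natSinv_lt (PosNum e0).
  by exists n; exact: (ne n (leqnn n)).
(* Slice [f] into [n.+1] superlevel sets. Only the bound for [P] loses a unit, which after division
   costs [1 / n.+1 < e]. *)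
suff : n.+1%:R * \int[P]_x f x <= 1 + n.+1%:R * a.
  move=> h; rewrite -(ler_pM2l (ltr0Sn R n)) (le_trans h)//.
  rewrite mulrDr addrC lerD2l -ler_pdivrMl ?ltr0n// mulr1.
  exact: ltW.
apply: (le_trans (layer_cake_ge P n mf f01)); rewrite lerD2l.
pose A (j : nat) := [set x | j.+1%:R / n.+1%:R < f x].
apply: (@le_trans _ _ (\sum_(j < n.+1) alpha (A j))).
  by apply: ler_sum => j _; exact: P_alpha.
have cvgS k : (fun m => \sum_(j < k) u (A j) m) @ U --> \sum_(j < k) alpha (A j).
  elim: k => [|k IH].
    by under eq_fun do rewrite big_ord0; rewrite big_ord0; exact: cvg_cst.
  under eq_fun do rewrite big_ord_recr/=.
  rewrite big_ord_recr/=; apply: cvgD => //; apply: ucvg.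
  exact: (open_preimage_measurable (openA _)).
rewrite -(cvg_lim _ (cvgS n.+1))//; apply: limr_le.
  by apply/cvg_ex; eexists; exact: cvgS.
apply: sU; apply: filterS fa => m fa.
apply: le_trans (_ : n.+1%:R * \int[P_ m]_s f (i s) <= _); last first.
  by rewrite ler_pM2l ?ltr0n.
by apply: (layer_cake_le (P_ m) n mfi) => x; exact: f01.
Qed.

End weak_limit.

(** Dominated convergence with the constant 1 as dominating function. *)
Lemma Rintegral_unit_cvg d (S : measurableType d) (R : realType)
    (P : probability S R) (g : nat -> S -> R) (f : S -> R) :
  (forall n, measurable_fun setT (g n)) -> (forall n x, 0 <= g n x <= 1) ->
  (forall x, 0 <= f x <= 1) -> measurable_fun setT f ->
  (forall x, g n x @[n --> \oo] --> f x) ->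
  \int[P]_x g n x @[n --> \oo] --> \int[P]_x f x.
Proof.
move=> mg g01 f01 mf gf.
have fi : P.-integrable setT (EFin \o f) by exact: unit_integrable.
have h : (\int[P]_x (EFin \o g n) x)%E @[n --> \oo] --> (\int[P]_x (f x)%:E)%E.
  apply: (@dominated_cvg _ S R P setT measurableT (fun n => EFin \o g n)
    (EFin \o f) (cst 1%E)) => //.
  - by move=> n; exact/measurable_EFinP.
  - by move=> x _; apply: cvg_EFin => //; [exact: filterE|exact: gf].
  - by apply: (@unit_integrable _ _ _ _ (cst 1)) => // x; rewrite lexx ler01.
  - move=> n x _; rewrite /= lee_fin.
    by have /andP[g0 g1] := g01 n x; rewrite ger0_norm.
move: h; rewrite -[(\int[P]_x _)%E]fineK; last exact: (integrable_fin_num _ fi).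
by move=> /fine_cvgP[].
Qed.

(** * Countable bases and measurability of open sets *)

Section enumerated_bases.

Definition enum_basis (T : topologicalType) (b : nat -> set T) :=
  (forall n, open (b n)) /\
  forall x V, nbhs x V -> exists2 n, b n x & b n `<=` V.

Lemma second_countable_enum (T : topologicalType) :
  @second_countable T -> exists b : nat -> set T, enum_basis b.
Proof.
move=> [B cB [oB nB]]; have [B0|[f]] := pfcard_geP cB.
  exists (fun=> set0); split => [n|x V /(nB x V)[U []]]; first exact: open0.
  by rewrite B0.
exists f; split => [n|x V /(nB x V)[U [BU Ux] UV]].
  by apply: oB; exact: (@funS _ _ _ _ f).
by have [n _ nU] := @surj _ _ _ _ f _ BU; exists n; rewrite nU.
Qed.

(** A single index codes a pair of indices; numbers that code no pair fall back on [(0, 0)], which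
    only repeats a box. *)
Definition prod_enum (T1 T2 : Type) (b1 : nat -> set T1) (b2 : nat -> set T2)
    (n : nat) : set (T1 * T2) :=
  let p : nat * nat := odflt (0, 0)%N (unpickle n) in b1 p.1 `*` b2 p.2.

Lemma open_setX (T1 T2 : topologicalType) (A : set T1) (B : set T2) :
  open A -> open B -> open (A `*` B).
Proof.
rewrite !openE => oA oB [x y] [/= Ax By]; exists (A, B) => //=.
by split; [exact: oA|exact: oB].
Qed.

Lemma prod_enum_basis (T1 T2 : topologicalType) b1 b2 :
  @enum_basis T1 b1 -> @enum_basis T2 b2 -> enum_basis (prod_enum b1 b2).
Proof.
move=> [op1 nb1] [op2 nb2]; split => [n|[x y] V [[A B] [/= Ax By] ABV]].
  exact: open_setX.
have [i ix iA] := nb1 _ _ Ax; have [j jy jB] := nb2 _ _ By.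
exists (pickle (i, j)); rewrite /prod_enum pickleK//=.
by move=> z [/iA Az /jB Bz]; exact: ABV.
Qed.

Lemma enum_basis_bigcup (T : topologicalType) b (G : set T) : enum_basis b ->
  open G -> G = \bigcup_(n in [set n | b n `<=` G]) b n.
Proof.
move=> [ob nb] oG; apply/seteqP; split => [x Gx|x [n /= bG /bG]//].
by have [n bx bG] := nb x G (open_nbhs_nbhs (conj oG Gx)); exists n.
Qed.

(** An open set is a countable union of basic ones. This puts the open sets of a product space in
    the product sigma-algebra. *)
Lemma enum_basis_measurable (T : topologicalType) b d (S : measurableType d)
    (i : S -> T) : enum_basis b ->
  (forall n, measurable (i @^-1` (b n))) ->
  forall G, open G -> measurable (i @^-1` G).
Proof.
move=> eb mb G oG; rewrite (enum_basis_bigcup eb oG) preimage_bigcup.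
by apply: bigcup_measurable => n _; exact: mb.
Qed.

End enumerated_bases.

(** * Separation properties of products and of locally compact spaces *)

Section product_separation.

Lemma hausdorff_prod (T1 T2 : topologicalType) : hausdorff_space T1 ->
  hausdorff_space T2 -> hausdorff_space (T1 * T2)%type.
Proof.
move=> h1 h2 [x1 x2] [y1 y2] cl; congr (_, _).
- apply: h1 => A B Ax By.
  have [|| [z1 z2] [/= Az Bz]] := cl (A `*` setT) (B `*` setT).
  + by exists (A, setT) => //=; split => //; exact: filterT.
  + by exists (B, setT) => //=; split => //; exact: filterT.
  + by exists z1; split; [case: Az|case: Bz].
- apply: h2 => A B Ax By.
  have [|| [z1 z2] [/= Az Bz]] := cl (setT `*` A) (setT `*` B).
  + by exists (setT, A) => //=; split => //; exact: filterT.
  + by exists (setT, B) => //=; split => //; exact: filterT.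
  + by exists z2; split; [case: Az|case: Bz].
Qed.

Lemma regular_prod (T1 T2 : topologicalType) : regular_space T1 ->
  regular_space T2 -> regular_space (T1 * T2)%type.
Proof.
move=> r1 r2 [x y] V [[A B] [/= Ax By] ABV].
have [C Cx CA] := r1 x A Ax; have [D Dy DB] := r2 y B By.
exists (C `*` D); first by exists (C, D).
move=> [u v] cl; apply: ABV; split => /=.
- apply: CA => W Wu; have [|[z1 z2] [[/= ? ?] [/= ? ?]]] := cl (W `*` setT).
    by exists (W, setT) => //=; split => //; exact: filterT.
  by exists z1.
- apply: DB => W Wv; have [|[z1 z2] [[/= ? ?] [/= ? ?]]] := cl (setT `*` W).
    by exists (setT, W) => //=; split => //; exact: filterT.
  by exists z2.
Qed.

Lemma locally_compact_nbhs (T : topologicalType) :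
  locally_compact [set: T] -> forall x : T, exists2 V, nbhs x V &
    compact (closure V).
Proof.
move=> lc x; have [V + [cV clV]] := lc x Logic.I.
move=> nV; exists V; last by move/closure_id: clV => <-.
by move: nV; rewrite /within /=; apply: filterS => y; exact.
Qed.

Lemma locally_compact_regular (T : topologicalType) : hausdorff_space T ->
  locally_compact [set: T] -> regular_space T.
Proof.
move=> h lc x; have [V Vx cV] := locally_compact_nbhs lc x.
apply: (compact_regular h cV); apply: filterS Vx; exact: subset_closure.
Qed.

End product_separation.

(** * Continuous approximation of indicators of open sets *)

Section distance_to_complement.
Context (R : realType) (E : topologicalType) (d : E -> E -> R).
Hypotheses (d_ge0 : forall x y, 0 <= d x y)
  (d_eq0 : forall x y, d x y = 0 <-> x = y)
  (d_sym : forall x y, d x y = d y x)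
  (d_triangle : forall x y z, d x z <= d x y + d y z)
  (d_nbhs : forall (x : E) (A : set E), nbhs x A <->
     exists2 e : R, 0 < e & [set y | d x y < e] `<=` A).

Lemma lipschitz_continuous (f : E -> R) (k : R) : 0 <= k ->
  (forall x y, f x <= f y + k * d x y) -> continuous f.
Proof.
move=> k0 fk x; apply/cvgrPdist_le => e e0; apply/d_nbhs.
(* Dividing by [k + 1] rather than [k] covers the case [k = 0]. *)
exists (e / (k + 1)); first by rewrite divr_gt0// ltr_wpDl.
move=> y /= xy.
have kd : k * d x y <= e.
  apply: (@le_trans _ _ ((k + 1) * d x y)).
    by rewrite ler_wpM2r// lerDl.
  by rewrite mulrC -ler_pdivlMr ?ltr_wpDl// ltW.
rewrite ler_distl; apply/andP; split.
  by rewrite lerBlDr (le_trans (fk y x))// lerD2l d_sym.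
by rewrite (le_trans (fk x y))// lerD2l.
Qed.

(** The approximants are [min 1 (k * dist x)], with [dist] the distance to the complement of [U]:
    they are [k]-Lipschitz, vanish off [U], and reach 1 at each point of [U] once [k] is large. *)
Lemma open_indic_approx (U : set E) : open U ->
  exists phi : nat -> E -> R, [/\ forall k, continuous (phi k),
    forall k x, 0 <= phi k x <= 1, forall k x, phi k x <= \1_U x &
    forall x, phi k x @[k --> \oo] --> (\1_U x : R)].
Proof.
(* When [U] is the whole space there is no distance to its complement, and the constant 1 serves. *)
move=> oU; have [[w nUw]|/forallNP UT] := pselect (exists w, ~ U w); last first.
  have {}UT : U = setT by apply/seteqP; split => // x _; exact: contrapT (UT x).
  exists (fun _ _ => 1); rewrite UT indicT; split => [k x|k x|k x|x] //.
  - exact: cvg_cst.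
  - by rewrite lexx ler01.
  - exact: cvg_cst.
pose dist x := inf [set d x z | z in ~` U].
have dist_le x z : ~ U z -> dist x <= d x z.
  by move=> nUz; apply: ge_inf; [exists 0 => _ [? _ <-]|exists z].
have dist_ge x r : (forall z, ~ U z -> r <= d x z) -> r <= dist x.
  by move=> h; apply: lb_le_inf; [exists (d x w), w|move=> _ [z nUz <-]; exact: h].
have dist0 x : 0 <= dist x by exact: dist_ge.
exists (fun k x => Num.min 1 (k%:R * dist x)).
have out k x : ~ U x -> Num.min 1 (k%:R * dist x) = 0.
  move=> nUx; have -> : dist x = 0.
    apply/eqP; rewrite eq_le dist0 andbT.
    by rewrite (le_trans (dist_le x x nUx))// (d_eq0 x x).2.
  by rewrite mulr0 min_r// ler01.
have phi01 k x : 0 <= Num.min 1 (k%:R * dist x) <= 1.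
  by rewrite le_min ler01 mulr_ge0//= ge_min lexx.
split => //.
- move=> k; apply: (@lipschitz_continuous _ k%:R) => // x y.
  rewrite addr_minl le_min !ge_min -mulrDr ler_wpM2l ?orbT ?andbT//; last first.
    rewrite -lerBlDr; apply: dist_ge => z nUz; rewrite lerBlDr addrC.
    by rewrite (le_trans (dist_le x z nUz)).
  by rewrite lerDl mulr_ge0.
- move=> k x; have [Ux|nUx] := pselect (U x).
    by rewrite indicE mem_set//; case/andP: (phi01 k x).
  by rewrite out// indicE memNset.
- move=> x; have [Ux|nUx] := pselect (U x); last first.
    by under eq_fun do rewrite out//; rewrite indicE memNset//; exact: cvg_cst.
  rewrite indicE mem_set//.
  have /d_nbhs[e e0 eU] : nbhs x U by exact: open_nbhs_nbhs.
  have ed : e <= dist x.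
    by apply: dist_ge => z nUz; rewrite leNgt; apply/negP => /eU.
  apply: cvg_near_cst; near=> k; rewrite min_l//.
  rewrite (@le_trans _ _ (k%:R * e))//; last by rewrite ler_wpM2l.
  rewrite -ler_pdivrMr// div1r; near: k; exact: nbhs_infty_ger.
Unshelve. all: by end_near. Qed.

End distance_to_complement.

Lemma polish_open_indic_approx (R : realType) (E : topologicalType) :
  polish R E -> forall U : set E, open U ->
  exists phi : nat -> E -> R, [/\ forall k, continuous (phi k),
    forall k x, 0 <= phi k x <= 1, forall k x, phi k x <= \1_U x &
    forall x, phi k x @[k --> \oo] --> (\1_U x : R)].
Proof.
move=> [[d [[d_ge0 d_eq0] d_sym d_triangle d_nbhs _]] _] U.
exact: (open_indic_approx d_ge0 d_eq0 d_sym d_triangle d_nbhs).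
Qed.

Lemma continuous_borel_measurable (R : realType) (T : ptopologicalType)
  (f : T -> R) : continuous f -> measurable_fun setT (f : borel T -> R).
Proof.
move=> /continuousP cf; apply: measurable_fun_superlevel => a.
by apply: sub_sigma_algebra; rewrite -preimage_itvoy; exact: cf.
Qed.

Lemma borel_closed_measurable (T : ptopologicalType) (A : set T) :
  closed A -> measurable (A : set (borel T)).
Proof.
move=> cA; rewrite -(setCK A); apply: measurableC.
by apply: sub_sigma_algebra; exact: closed_openC.
Qed.

(** * Weak convergence: uniqueness, portmanteau, tightness *)

Section weak_convergence.
Context (R : realType) (E : ptopologicalType).
Hypothesis E_lc : locally_compact [set: E].
Hypotheses (E_sc : @second_countable E) (E_polish : polish R E).

Lemma Rintegral_open_approx (mu : probability (borel E) R) (U : set E)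
    (phi : nat -> E -> R) : open U -> (forall k, continuous (phi k)) ->
  (forall k x, 0 <= phi k x <= 1) ->
  (forall x, phi k x @[k --> \oo] --> (\1_U x : R)) ->
  \int[mu]_x phi k x @[k --> \oo] --> fine (mu U).
Proof.
move=> oU cphi phi01 phiU; have mU : measurable (U : set (borel E)).
  exact: sub_sigma_algebra.
rewrite -Rintegral_indic//; apply: Rintegral_unit_cvg => //.
- by move=> n; exact: continuous_borel_measurable.
- by move=> x; rewrite indicE ler0n lern1 leq_b1.
Qed.

(** Masses of open sets are limits of integrals of continuous functions, and open sets form a
    generating class stable under intersection. *)
Lemma probability_eq_continuous (mu nu : probability (borel E) R) :
  (forall f : E -> R, continuous f -> (forall x, 0 <= f x <= 1) ->
     \int[mu]_x f x = \int[nu]_x f x) ->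
  forall A : set (borel E), measurable A -> mu A = nu A.
Proof.
move=> munu A mA.
apply: (@g_sigma_algebra_measure_unique _ R (borel E) (@open E) _ (fun=> setT))
  => //.
- by move=> U oU; exact: sub_sigma_algebra.
- by move=> _; exact: openT.
- by rewrite bigcup_const//; exists 0%N.
- by move=> U V; exact: openI.
- move=> U oU; have [phi [cphi phi01 _ phiU]] :=
    polish_open_indic_approx E_polish oU.
  have mU : measurable (U : set (borel E)) by exact: sub_sigma_algebra.
  rewrite -[LHS]fineK ?fin_num_measure// -[RHS]fineK ?fin_num_measure//.
  congr (_%:E); have := Rintegral_open_approx (mu := mu) oU cphi phi01 phiU.
  under eq_fun do rewrite munu//.
  move=> /(cvg_unique (@Rhausdorff R)); apply.
  exact: Rintegral_open_approx.
- by move=> _; rewrite [ltLHS]probability_setT ltry.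
Qed.

(** Some continuous [phi k] below the indicator of [U] already has [mu]-integral above [a], and weak
    convergence applies to it. *)
Lemma portmanteau_open (mu_ : nat -> probability (borel E) R)
    (mu : probability (borel E) R) (U : set E) a :
  weak_cvg (fun n => mu_ n) mu -> open U -> a < fine (mu U) ->
  \forall n \near \oo, a < fine (mu_ n U).
Proof.
move=> mucvg oU aU; have [phi [cphi phi01 phi_le phiU]] :=
  polish_open_indic_approx E_polish oU.
have mU : measurable (U : set (borel E)) by exact: sub_sigma_algebra.
have [k ak] : exists k, a < \int[mu]_x phi k x.
  have := Rintegral_open_approx (mu := mu) oU cphi phi01 phiU.
  by move=> /(cvgr_gt _)/(_ _ aU)[k _ kP]; exists k; exact: kP (leqnn k).
have bphi : exists M : R, forall x, `|phi k x| <= M.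
  by exists 1 => x; have /andP[? ?] := phi01 k x; rewrite ger0_norm.
have := mucvg _ (cphi k) bphi => /(cvgr_gt _)/(_ _ ak).
apply: filterS => n /lt_le_trans; apply; rewrite -Rintegral_indic//.
apply: le_Rintegral => //; last exact: indic_integrable.
by apply: unit_integrable => //; exact: continuous_borel_measurable.
Qed.

(** Relatively compact basic open sets cover [E], so a finite union of them has [mu]-mass above
    [1 - e]. By portmanteau its [mu_ n]-mass is eventually as large, and its closures form the
    compact set. *)
Lemma weak_cvg_tight (mu_ : nat -> probability (borel E) R)
    (mu : probability (borel E) R) : weak_cvg (fun n => mu_ n) mu ->
  forall e : R, 0 < e -> exists2 K : set E, compact K &
    \forall n \near \oo, 1 - e <= fine (mu_ n K).
Proof.
move=> mucvg e e0; have [b [ob nb]] := second_countable_enum E_sc.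
(* Basic sets without compact closure are replaced by the empty set, which keeps the numbering. *)
pose O n := if `[< compact (closure (b n)) >] then b n else set0.
have oO n : open (O n) by rewrite /O; case: ifPn => // _; exact: open0.
have cO n : compact (closure (O n)).
  by rewrite /O; case: asboolP => // _; rewrite closure0; exact: compact0.
pose U N := \big[setU/set0]_(i < N) O i.
have oU N : open (U N).
  by apply: (big_ind (@open E)); [exact: open0|exact: openU|move=> i _].
have mU N : measurable (U N : set (borel E)) by exact: sub_sigma_algebra.
have UT : \bigcup_N U N = setT.
  apply/seteqP; split => // x _.
  have [V Vx cV] := locally_compact_nbhs E_lc x.
  have [n bnx bnV] := nb x V Vx.
  exists n.+1 => //; rewrite /U big_ord_recr/=; right; rewrite /O.
  case: asboolP => // -[]; apply: subclosed_compact cV _; first exact: closed_closure.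
  exact: closureS.
have Ucvg : fine (mu (U N)) @[N --> \oo] --> (1 : R).
  have /fine_cvgP[_ //] : mu (U N) @[N --> \oo] --> (1 : R)%:E.
  rewrite -(probability_setT mu) -UT; apply: nondecreasing_cvg_mu => //.
  - by rewrite UT.
  - by move=> m n mn; apply/subsetPset; exact: subset_bigsetU.
have [N UN] : exists N, 1 - e < fine (mu (U N)).
  have : 1 - e < 1 by rewrite ltrBlDr ltrDl.
  by move: Ucvg => /(cvgr_gt _)/[apply] -[N _ NP]; exists N; exact: NP (leqnn N).
exists (\big[setU/set0]_(i < N) closure (O i)); first exact: bigsetU_compact.
have := portmanteau_open mucvg (oU N) UN; apply: filterS => n /ltW/le_trans; apply.
have mK : measurable (\big[setU/set0]_(i < N) closure (O i) : set (borel E)).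
  apply: bigsetU_measurable => i _; apply: borel_closed_measurable.
  exact: closed_closure.
rewrite fine_le ?fin_num_measure// le_measure ?inE//.
rewrite /U -(bigcup_mkord N O) -(bigcup_mkord N (fun i => closure (O i))).
by apply: subset_bigcup => i _; exact: subset_closure.
Qed.

End weak_convergence.

(** * Change of variables and marginals of limit laws *)

(** [Q] has to agree with the image law on measurable sets only, which is what the definition of a
    coupling provides. *)
Lemma Rintegral_pushforward d d' (S : measurableType d) (S' : measurableType d')
    (R : realType) (mu : {measure set S -> \bar R}) (h : S -> S')
    (Q : probability S' R) (f : S' -> R) :
  measurable_fun setT h ->
  (forall A, measurable A -> Q A = mu (h @^-1` A)) ->
  measurable_fun setT f -> (forall x, 0 <= f x) ->
  \int[Q]_x f x = \int[mu]_x f (h x).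
Proof.
move=> mh QE mf f0.
have mu1 : mu setT = 1%E.
  by have := QE setT measurableT; rewrite preimage_setT => <-; exact: probability_setT.
have [Q' Q'E] := pushforward_probability mh mu1.
rewrite /Rintegral (@eq_measure_integral _ _ _ _ Q'); last first.
  by move=> A mA _; exact: etrans (QE A mA) (esym (congr1 (@^~ A) Q'E)).
rewrite [X in integral X _ _]Q'E ge0_integral_pushforward//.
- exact/measurable_EFinP.
- by move=> x _; rewrite lee_fin.
Qed.

Lemma continuous_borel_fun (T T' : ptopologicalType) (f : T -> T') :
  continuous f -> measurable_fun setT (f : borel T -> borel T').
Proof.
move=> /continuousP cf.
apply: (@measurability _ _ (borel T) (borel T') setT f (@open T') erefl).
move=> _ [U oU <-]; rewrite setTI; apply: sub_sigma_algebra; exact: cf.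
Qed.

Lemma probability_setI_ge d (S : measurableType d) (R : realType)
    (P : probability S R) (A B : set S) : measurable A -> measurable B ->
  fine (P A) + fine (P B) - 1 <= fine (P (A `&` B)).
Proof.
move=> mA mB; have mAB := measurableI _ _ mA mB; have mD := measurableD mA mB.
have -> : fine (P A) = fine (P (A `\` B)) + fine (P (A `&` B)).
  by rewrite -fineD ?fin_num_measure// -measureDI.
have : fine (P (A `\` B)) <= fine (P (~` B)).
  have mC := measurableC mB.
  rewrite fine_le ?fin_num_measure// le_measure ?inE//.
rewrite probability_setC// fineB ?fin_num_measure//=.
lra.
Qed.

(** Lets [E * E] and [(E * E) * E] serve as the space [T] of [prokhorov]. *)
HB.instance Definition _ (T1 T2 : ptopologicalType) :=
  Pointed.copy (T1 * T2)%type (T1 * T2)%type.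

Section limit_marginals.
Context (R : realType) (E : ptopologicalType) (E_polish : polish R E).
Context (T : ptopologicalType) d (S : measurableType d) (i : S -> T).
Variables (P_ : nat -> probability S R) (P : probability (borel T) R).
Hypothesis P_lim : forall f : T -> R, (forall x, 0 <= f x <= 1) ->
  lower_semicontinuous (EFin \o f) ->
  forall a, (\forall n \near \oo, \int[P_ n]_s f (i s) <= a) ->
  \int[P]_x f x <= a.

Lemma continuous_lsc (T' : topologicalType) (f : T' -> R) :
  continuous f -> lower_semicontinuous (EFin \o f).
Proof.
move=> /continuousP cf; apply/lower_semicontinuousP => a.
exact: (cf _ (@open_gt R a)).
Qed.

(** [P_lim] gives only an upper bound on integrals; for continuous [f] it applies to both [f] and
    [1 - f], whence equality. *)
Lemma limit_marginal (g : T -> E) (mu_ : nat -> probability (borel E) R)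
    (mu : probability (borel E) R) : continuous g ->
  measurable_fun setT (g \o i : S -> borel E) ->
  (forall n (A : set (borel E)), measurable A ->
     mu_ n A = P_ n ((g \o i) @^-1` A)) ->
  weak_cvg (fun n => mu_ n) mu ->
  forall A : set (borel E), measurable A -> P (g @^-1` A) = mu A.
Proof.
move=> cg mgi mu_E mucvg A mA.
have mg := continuous_borel_fun cg.
have [Q QE] := pushforward_probability mg (probability_setT P).
rewrite -[LHS]/(pushforward P (g : borel T -> borel E) A) -QE.
have half (f : E -> R) : continuous f -> (forall x, 0 <= f x <= 1) ->
    \int[Q]_x f x <= \int[mu]_x f x.
  move=> cf f01; have mf := continuous_borel_measurable cf.
  have f0 x : 0 <= f x by case/andP: (f01 x).
  rewrite (Rintegral_pushforward mg (Q := Q) (mu := P))//; last by move=> *; rewrite QE.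
  apply/ler_addgt0Pr => e e0; apply: (P_lim (f := f \o g)).
  - by move=> x; exact: f01.
  - by apply: continuous_lsc => x; apply: continuous_comp; [exact: cg|exact: cf].
  - have bf : exists M : R, forall x, `|f x| <= M.
      by exists 1 => x; have /andP[? ?] := f01 x; rewrite ger0_norm.
    have := mucvg f cf bf => /(cvgr_le _).
    move=> /(_ (\int[mu]_x f x + e)); rewrite ltrDl => /(_ e0).
    apply: filterS => n; apply: le_trans.
    by rewrite (Rintegral_pushforward mgi (Q := mu_ n) (mu := P_ n))//; exact: mu_E.
apply: (probability_eq_continuous E_polish) => // f cf f01.
apply/eqP; rewrite eq_le half//=.
have mf := continuous_borel_measurable cf.
(* Both laws have mass one, so the bound for [1 - f] is the reverse bound for [f]. *)
have := half (fun x => 1 - f x).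
rewrite !RintegralB//; try exact: unit_integrable; try by
  apply: (@unit_integrable _ _ _ _ (cst 1)) => // x; rewrite lexx ler01.
rewrite !Rintegral_cst// [X in fine X]probability_setT.
rewrite [X in _ <= 1 * fine X - _]probability_setT lerD2l lerN2; apply.
- by move=> x; apply: cvgB; [exact: cvg_cst|exact: cf].
- by move=> x; rewrite subr_ge0 gerBl andbC; case/andP: (f01 x) => -> ->.
Qed.

End limit_marginals.

(** * Compactness of couplings and existence of optimal ones *)

Section couplings.
Context (R : realType) (E : ptopologicalType).
Hypotheses (E_lc : locally_compact [set: E]) (E_hausdorff : hausdorff_space E).
Hypotheses (E_sc : @second_countable E) (E_polish : polish R E).
Implicit Types (mu nu : probability (borel E) R) (m : E -> E -> R).

Let E_regular : regular_space E := locally_compact_regular E_hausdorff E_lc.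

Lemma open_prod_measurable (G : set (E * E)) : open G ->
  measurable (G : set (borel E * borel E)%type).
Proof.
have [b bb] := second_countable_enum E_sc.
move=> oG; apply: (@enum_basis_measurable _ _ _ (borel E * borel E)%type id
  (prod_enum_basis bb bb) _ G oG) => n.
by apply: measurableX; apply: sub_sigma_algebra; exact: bb.1.
Qed.

(** The cost functions for which the transport problem is solved; the metric axioms are assumed
    separately where they matter. *)
Definition unit_lsc m := (forall x y, 0 <= m x y <= 1) /\
  lower_semicontinuous (fun z : E * E => (m z.1 z.2)%:E).

Lemma unit_lsc_measurable m : unit_lsc m ->
  measurable_fun setT (fun z : borel E * borel E => m z.1 z.2).
Proof.
move=> [_ lm]; apply: measurable_fun_superlevel => a.
exact: open_prod_measurable (lsc_superlevel_open a lm).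
Qed.

Lemma unit_lsc_integrable m (gamma : probability (borel E * borel E)%type R) :
  unit_lsc m -> gamma.-integrable setT (EFin \o (fun z => m z.1 z.2)).
Proof.
move=> um; apply: unit_integrable; first exact: unit_lsc_measurable.
by move=> z; exact: um.1.
Qed.

Lemma borel_prod_measurable (T : ptopologicalType) (g1 g2 : T -> E) :
  continuous g1 -> continuous g2 ->
  measurable_fun setT
    ((fun t => (g1 t, g2 t)) : borel T -> (borel E * borel E)%type).
Proof. by move=> c1 c2; apply: measurable_fun_pair; exact: continuous_borel_fun. Qed.

(** Couplings of tight marginals are tight, since a product of compact sets misses at most the sum
    of the two missing masses. The limit law then inherits the limits of the marginals. *)
Lemma limit_coupling (mu_ nu_ : nat -> probability (borel E) R) mu nu
    (gamma_ : nat -> probability (borel E * borel E)%type R) :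
  weak_cvg (fun n => mu_ n) mu -> weak_cvg (fun n => nu_ n) nu ->
  (forall n, coupling (mu_ n) (nu_ n) (gamma_ n)) ->
  exists2 gamma, coupling mu nu gamma & forall m, unit_lsc m ->
    forall a, (\forall n \near \oo, \int[gamma_ n]_z m z.1 z.2 <= a) ->
    \int[gamma]_z m z.1 z.2 <= a.
Proof.
move=> mucvg nucvg cpl.
have mK (K : set E) : compact K -> measurable (K : set (borel E)).
  by move=> cK; apply: borel_closed_measurable; exact: compact_closed.
have [|P Plim] := @prokhorov R (E * E)%type _ (borel E * borel E)%type id gamma_
  (hausdorff_prod E_hausdorff E_hausdorff) (regular_prod E_regular E_regular)
  open_prod_measurable.
  move=> e e0; have e20 : 0 < e / 2 by rewrite divr_gt0.
  have [K cK Ke] := weak_cvg_tight E_lc E_sc E_polish mucvg e20.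
  have [L cL Le] := weak_cvg_tight E_lc E_sc E_polish nucvg e20.
  exists (K `*` L); first exact: compact_setX.
  near=> n; rewrite preimage_id.
  have Kn : 1 - e / 2 <= fine (mu_ n K) by near: n.
  have Ln : 1 - e / 2 <= fine (nu_ n L) by near: n.
  have [mKK mLL] := (mK _ cK, mK _ cL).
  have [KE _] := cpl n _ mKK; have [_ LE] := cpl n _ mLL.
  have mKT : measurable (K `*` setT : set (borel E * borel E)%type).
    exact: measurableX.
  have mTL : measurable (setT `*` L : set (borel E * borel E)%type).
    exact: measurableX.
  have := probability_setI_ge (gamma_ n) mKT mTL.
  rewrite KE LE -setXI setTI setIT.
  apply: le_trans; lra.
have mfst : continuous (@fst E E) by move=> x; exact: cvg_fst.
have msnd : continuous (@snd E E) by move=> x; exact: cvg_snd.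
(* The limit lives on the Borel sets of [E * E]; the identity carries it to the product
   sigma-algebra on which couplings are defined. *)
have mid := borel_prod_measurable mfst msnd.
have [gamma gE] := pushforward_probability mid (probability_setT P).
exists gamma.
  move=> A mA; rewrite gE /pushforward; split.
  - apply: etrans (limit_marginal E_polish Plim mfst measurable_fst _ mucvg mA).
      by congr (P _); apply/seteqP; split => z; [case|].
    move=> n B mB; apply: etrans (esym (cpl n B mB).1) _; congr (gamma_ n _).
    by apply/seteqP; split => z; [case|].
  - apply: etrans (limit_marginal E_polish Plim msnd measurable_snd _ nucvg mA).
      by congr (P _); apply/seteqP; split => z; [case|].
    move=> n B mB; apply: etrans (esym (cpl n B mB).2) _; congr (gamma_ n _).
    by apply/seteqP; split => z; [case|].
move=> m um a ma; rewrite (Rintegral_pushforward mid (mu := P))//=.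
- exact: (Plim (fun z => m z.1 z.2)) (fun z => um.1 z.1 z.2) um.2 _ ma.
- by move=> A mA; rewrite gE.
- exact: unit_lsc_measurable.
- by move=> z; case/andP: (um.1 z.1 z.2).
Unshelve. all: by end_near. Qed.

Lemma coupling_nonempty mu nu :
  exists gamma : probability (borel E * borel E)%type R, coupling mu nu gamma.
Proof.
exists (mu \x nu)%E => A mA; split; rewrite [LHS]product_measure1E//.
  by rewrite [X in (_ * X)%E]probability_setT mule1.
by rewrite [X in (X * _)%E]probability_setT mul1e.
Qed.

Lemma unit_lsc_Rintegral m (gamma : probability (borel E * borel E)%type R) :
  unit_lsc m -> 0 <= \int[gamma]_z m z.1 z.2 <= 1.
Proof.
move=> um; rewrite Rintegral_ge0/=; last first.
  by move=> z _; case/andP: (um.1 z.1 z.2).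
have -> : (1 = \int[gamma]_z (cst 1 z : R))%R.
  by rewrite Rintegral_cst// mul1r [X in fine X]probability_setT.
apply: le_Rintegral => //; first exact: unit_lsc_integrable.
  by apply: (@unit_integrable _ _ _ _ (cst 1)) => // x; rewrite lexx ler01.
by move=> z _; case/andP: (um.1 z.1 z.2).
Qed.

Lemma W_le m mu nu gamma : unit_lsc m -> coupling mu nu gamma ->
  W m mu nu <= \int[gamma]_z m z.1 z.2.
Proof.
move=> um cpl; apply: ge_inf; last by exists gamma.
by exists 0 => _ [g _ <-]; case/andP: (unit_lsc_Rintegral g um).
Qed.

Lemma weak_cvg_cst mu : weak_cvg (fun=> mu) mu.
Proof. by move=> f _ _; exact: cvg_cst. Qed.

(** A minimising sequence is a sequence of couplings with constant marginals, and the limit coupling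
    does at least as well. *)
Lemma W_attained m mu nu : unit_lsc m ->
  exists2 gamma, coupling mu nu gamma & \int[gamma]_z m z.1 z.2 = W m mu nu.
Proof.
move=> um; have hinf : has_inf [set \int[g]_z m z.1 z.2 | g in coupling mu nu].
  split; last by exists 0 => _ [g _ <-]; case/andP: (unit_lsc_Rintegral g um).
  by have [g cg] := coupling_nonempty mu nu; eexists; exists g.
have /choice[gamma_ gP] : forall n, exists g : probability _ R,
    coupling mu nu g /\ \int[g]_z m z.1 z.2 < W m mu nu + n.+1%:R^-1.
  move=> n; have n0 : 0 < n.+1%:R^-1 :> R by rewrite invr_gt0.
  by have [_ [g cg <-] gW] := inf_adherent n0 hinf; exists g.
have [gamma cg gl] := limit_coupling (@weak_cvg_cst mu) (@weak_cvg_cst nu)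
  (fun n => (gP n).1).
exists gamma => //; apply/eqP; rewrite eq_le W_le// andbT.
apply/ler_addgt0Pr => e e0; apply: gl => //; near=> n.
apply: (le_trans (ltW (gP n).2)); rewrite lerD2l ltW//; near: n.
exact: (near_infty_natSinv_lt (PosNum e0)).
Unshelve. all: by end_near. Qed.

End couplings.

(** * Monotonicity, symmetry and continuity properties of [W] *)

Section W_properties.
Context (R : realType) (E : ptopologicalType).
Hypotheses (E_lc : locally_compact [set: E]) (E_hausdorff : hausdorff_space E).
Hypotheses (E_sc : @second_countable E) (E_polish : polish R E).
Implicit Types (mu nu rho : probability (borel E) R) (m : E -> E -> R).

Let W_attained := W_attained E_lc E_hausdorff E_sc E_polish.
Let limit_coupling := limit_coupling E_lc E_hausdorff E_sc E_polish.

Lemma pseudometrics_unit_lsc m : pseudometrics m -> unit_lsc m.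
Proof. by case. Qed.

Lemma W01 m mu nu : unit_lsc m -> 0 <= W m mu nu <= 1.
Proof.
move=> um; have [g _ <-] := W_attained mu nu um; exact: unit_lsc_Rintegral.
Qed.

Lemma le_W m m' mu nu : unit_lsc m -> unit_lsc m' ->
  (forall x y, m x y <= m' x y) -> W m mu nu <= W m' mu nu.
Proof.
move=> um um' mm'; have [g cg <-] := W_attained mu nu um'.
apply: (le_trans (W_le E_sc um cg)); apply: le_Rintegral => //;
  exact: unit_lsc_integrable.
Qed.

(** The diagonal coupling costs nothing. *)
Lemma W_refl m mu : unit_lsc m -> (forall x, m x x = 0) -> W m mu mu = 0.
Proof.
move=> um m0; have mdiag : measurable_fun setT
    ((fun x => (x, x)) : borel E -> (borel E * borel E)%type).
  by apply: measurable_fun_pair; exact: measurable_id.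
have [g gE] := pushforward_probability mdiag (probability_setT mu).
apply/eqP; rewrite eq_le; case/andP: (W01 mu mu um) => -> _; rewrite andbT.
have cg : coupling mu mu g.
  move=> A mA; rewrite gE /pushforward.
  by split; congr (mu _); apply/seteqP; split => x //=; case.
apply: (le_trans (W_le E_sc um cg)).
rewrite (Rintegral_pushforward mdiag (mu := mu)).
- by under eq_Rintegral do rewrite /= m0; rewrite Rintegral_cst// mul0r.
- by move=> A mA; rewrite gE.
- exact: unit_lsc_measurable.
- by move=> z; case/andP: (um.1 z.1 z.2).
Qed.

(** Swapping the coordinates of an optimal coupling of [nu] and [mu] gives a coupling of [mu] and
    [nu] of equal cost. *)
Lemma W_sym_le m mu nu : unit_lsc m -> (forall x y, m x y = m y x) ->
  W m mu nu <= W m nu mu.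
Proof.
move=> um msym; have [g cg <-] := W_attained nu mu um.
have mswap : measurable_fun setT
    ((fun z => (z.2, z.1)) :
     (borel E * borel E)%type -> (borel E * borel E)%type).
  by apply: measurable_fun_pair; [exact: measurable_snd|exact: measurable_fst].
have [h hE] := pushforward_probability mswap (probability_setT g).
have ch : coupling mu nu h.
  move=> A mA; have [gA1 gA2] := cg A mA; rewrite hE /pushforward.
  split; [apply: etrans gA2|apply: etrans gA1]; congr (g _);
    by apply/seteqP; split => z /= [].
apply: (le_trans (W_le E_sc um ch)).
rewrite (Rintegral_pushforward mswap (mu := g)).
- by under eq_Rintegral do rewrite /= msym.
- by move=> A mA; rewrite hE.
- exact: unit_lsc_measurable.
- by move=> z; case/andP: (um.1 z.1 z.2).
Qed.

Lemma W_sym m mu nu : unit_lsc m -> (forall x y, m x y = m y x) ->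
  W m mu nu = W m nu mu.
Proof. by move=> um ms; apply/eqP; rewrite eq_le !W_sym_le. Qed.

(** Take a limit of optimal couplings of [mu_ n] and [nu_ n]. *)
Lemma W_lsc_seq m (mu_ nu_ : nat -> probability (borel E) R) mu nu a :
  unit_lsc m -> weak_cvg (fun n => mu_ n) mu -> weak_cvg (fun n => nu_ n) nu ->
  (forall n, W m (mu_ n) (nu_ n) <= a) -> W m mu nu <= a.
Proof.
move=> um mucvg nucvg Wa.
have /choice[g gP] : forall n, exists g : probability _ R,
    coupling (mu_ n) (nu_ n) g /\ \int[g]_z m z.1 z.2 = W m (mu_ n) (nu_ n).
  by move=> n; have [g cg gW] := W_attained (mu_ n) (nu_ n) um; exists g.
have [gamma cg gl] := limit_coupling mucvg nucvg (fun n => (gP n).1).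
apply: (le_trans (W_le E_sc um cg)); apply: gl => //.
by apply: nearW => n; rewrite (gP n).2.
Qed.

(** Let [g n] be optimal for [m_ n]. For [k <= n] the [m_ k]-cost of [g n] is at most
    [W (m_ n) mu nu <= a]. Let [n] grow first, which bounds the [m_ k]-cost of the limit coupling,
    and then [k]. *)
Lemma W_sup_le (m_ : nat -> E -> E -> R) m mu nu a :
  (forall n, unit_lsc (m_ n)) -> unit_lsc m ->
  (forall n k x y, (n <= k)%N -> m_ n x y <= m_ k x y) ->
  (forall x y, m_ n x y @[n --> \oo] --> m x y) ->
  (forall n, W (m_ n) mu nu <= a) -> W m mu nu <= a.
Proof.
move=> um_ um ndm mcvg Wa.
have /choice[g gP] : forall n, exists g : probability _ R,
    coupling mu nu g /\ \int[g]_z m_ n z.1 z.2 = W (m_ n) mu nu.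
  by move=> n; have [g cg gW] := W_attained mu nu (um_ n); exists g.
have [gamma cg gl] := limit_coupling (@weak_cvg_cst _ _ mu)
  (@weak_cvg_cst _ _ nu) (fun n => (gP n).1).
apply: (le_trans (W_le E_sc um cg)).
have : \int[gamma]_z m_ n z.1 z.2 @[n --> \oo] --> \int[gamma]_z m z.1 z.2.
  apply: Rintegral_unit_cvg.
  - by move=> n; exact: unit_lsc_measurable.
  - by move=> n z; exact: (um_ n).1.
  - by move=> z; exact: um.1.
  - exact: unit_lsc_measurable.
  - by move=> z; exact: mcvg.
move=> /cvgr_to_le; apply; apply: nearW => k; apply: gl => //.
near=> n; apply: le_trans (Wa n); rewrite -(gP n).2.
apply: le_Rintegral => //; try exact: unit_lsc_integrable.
by move=> z _; apply: ndm; near: n; exact: nbhs_infty_ge.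
Unshelve. all: by end_near. Qed.

End W_properties.

(** * Tools for gluing: comparison by superlevel sets, finite partitions *)

(** Both integrals are layer-cake sums up to [1 / n.+1], so laws on different spaces can be compared
    level by level. *)
Lemma layer_cake_compare (R : realType) d d' (S : measurableType d)
    (S' : measurableType d') (P : probability S R) (Q : probability S' R)
    (f : S -> R) (g : S' -> R) :
  measurable_fun setT f -> measurable_fun setT g ->
  (forall x, 0 <= f x <= 1) -> (forall x, 0 <= g x <= 1) ->
  (forall a, fine (P [set x | a < f x]) <= fine (Q [set x | a < g x])) ->
  \int[P]_x f x <= \int[Q]_x g x.
Proof.
move=> mf mg f01 g01 PQ; apply/ler_addgt0Pr => e e0.
have [n ne] : exists n, n.+1%:R^-1 < e.
  have [n _ ne] := near_infty_natSinv_lt (PosNum e0).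
  by exists n; exact: (ne n (leqnn n)).
rewrite -(ler_pM2l (ltr0Sn R n)) (le_trans (layer_cake_ge P n mf f01))//.
rewrite mulrDr addrC lerD//; last first.
  by rewrite -ler_pdivrMl ?ltr0n// mulr1 ltW.
apply: le_trans (layer_cake_le Q n mg g01).
by apply: ler_sum => i _; exact: PQ.
Qed.

Lemma lsc_comp (R : realType) (T T' : topologicalType) (h : T -> T')
    (f : T' -> \bar R) : continuous h -> lower_semicontinuous f ->
  lower_semicontinuous (f \o h).
Proof.
move=> ch lf x a /lf[V nV VP]; exists (h @^-1` V); first exact: ch.
by move=> y; exact: VP.
Qed.

Lemma indic_lsc (R : realType) (T : topologicalType) (O : set T) : open O ->
  lower_semicontinuous (EFin \o (\1_O : T -> R)).
Proof.
move=> oO x a; rewrite /= lte_fin indicE; have [Ox|nOx] := pselect (O x).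
  rewrite mem_set// => a1; exists O; first exact: open_nbhs_nbhs.
  by move=> y Oy; rewrite lte_fin indicE mem_set.
rewrite memNset// => a0; exists setT; first exact: filterT.
by move=> y _; rewrite lte_fin (lt_le_trans a0)// indicE ler0n.
Qed.

Section cells.
Context (T : ptopologicalType) (b : nat -> set T).
Hypothesis b_open : forall n, open (b n).

(* Binary code of the membership of [y] in [b 0, ..., b n.-1]. *)
Fixpoint cell_code (n : nat) (y : T) : nat :=
  if n is n'.+1 then (cell_code n' y).*2 + `[< b n' y >] else 0.

Definition cell n i : set (borel T) := [set y | cell_code n y = i].

(** The parity of a code tells membership in the last basic set, and halving it gives the preceding
    code. *)
Lemma cell_code_mem n y y' : cell_code n y = cell_code n y' ->
  forall j, (j < n)%N -> b j y -> b j y'.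
Proof.
elim: n => //= n IH e j; rewrite ltnS leq_eqVlt => /predU1P[->{j}|jn].
  have : `[< b n y >] = `[< b n y' >].
    by have := congr1 odd e; rewrite !oddD !odd_double !oddb.
  by move=> e' /asboolP; rewrite e' => /asboolP.
apply: IH => //; have := congr1 half e.
by rewrite ![(_.*2 + _)%N]addnC !half_bit_double.
Qed.

Lemma cell_measurable n i : measurable (cell n i).
Proof.
elim: n i => [|n IH] i.
  rewrite /cell /=; case: i => [|i].
    by rewrite (_ : mkset _ = setT)//; apply/seteqP; split.
  by rewrite (_ : mkset _ = set0)//; apply/seteqP; split.
have mb : measurable (b n : set (borel T)) by exact: sub_sigma_algebra.
have -> : cell n.+1 i = if odd i then cell n i./2 `&` b n
                        else cell n i./2 `\` b n.
  apply/seteqP; split => y; rewrite /cell /=.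
    move=> <-; rewrite oddD odd_double oddb addnC half_bit_double.
    by case: asboolP.
  rewrite -[in X in _ -> _ = X](odd_double_half i); case: (odd i) => -[/= -> h].
    by rewrite asboolT// addnC.
  by rewrite asboolF// addnC.
by case: ifP => _; [exact: measurableI|exact: measurableD].
Qed.

End cells.

Lemma mnormalize_mass d (S : measurableType d) (R : realType)
    (m : {measure set S -> \bar R}) (P : probability S R) (A : set S) :
  m setT != 0%E -> m setT != +oo%E -> m A = (m setT * mnormalize m P A)%E.
Proof.
move=> m0 moo; rewrite /mnormalize (negbTE m0) (negbTE moo)/=.
have mfin : m setT \is a fin_num by rewrite ge0_fin_numE// ltey.
by rewrite -{1}(fineK mfin) muleCA -EFinM divff ?mule1// fine_eq0.
Qed.

(** * Gluing two couplings along a finite partition *)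

Section gluing.
Context (R : realType) (E : ptopologicalType).
Variables (mu nu rho : probability (borel E) R).
Variables (g1 g2 : probability (borel E * borel E)%type R).
Hypotheses (g1_cpl : coupling mu nu g1) (g2_cpl : coupling nu rho g2).

(** [Q] is the law of the second coordinate under [g2], conditioned on the first lying in [B]. *)
Lemma conditional_law (B : set (borel E)) : measurable B ->
  exists Q : probability (borel E) R, forall A, measurable A ->
    g2 (B `*` A) = (nu B * Q A)%E.
Proof.
move=> mB; have mBT : measurable (B `*` setT : set (borel E * borel E)%type).
  exact: measurableX.
have nuB := (g2_cpl mB).1.
have [B0|B0] := eqVneq (nu B) 0%E.
  (* Given a null event any law will do, as both sides vanish. *)
  exists rho => A mA; rewrite B0 mul0e; apply/eqP.
  rewrite eq_le measure_ge0 andbT -B0 -nuB le_measure ?inE//.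
    exact: measurableX.
  by move=> z [].
have mB1 : mrestr g2 mBT setT = nu B by apply: etrans nuB; rewrite /mrestr setTI.
have [Q QE] := pushforward_probability (@measurable_snd _ _ (borel E) (borel E))
  (probability_setT (mnormalize (mrestr g2 mBT) g2)).
exists Q => A mA; rewrite QE -[X in (X * _)%E]mB1.
apply: etrans (@mnormalize_mass _ _ _ (mrestr g2 mBT) g2 (snd @^-1` A) _ _).
- congr (g2 _); apply/seteqP; split => -[y z] /=; first by move=> [].
  by move=> [? []].
- by rewrite [X in X != _]mB1.
- have : nu B \is a fin_num by exact: fin_num_measure.
  by rewrite [X in X != _]mB1; apply: contraTneq => ->.
Qed.

Variable b : nat -> set E.
Hypothesis b_open : forall n, open (b n).

(** Sets that see their first coordinate only through its cell; on these the glued law reproduces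
    [g2] exactly. *)
Definition saturated n (O : set (borel E * borel E)%type) :=
  forall y y' z, cell_code b n y = cell_code b n y' -> O (y, z) -> O (y', z).

Let S3 := ((borel E * borel E) * borel E)%type.

(** Given that the middle point is in cell [i], draw the third from its conditional law [Q i],
    independently of the first two. Then middle in cell [i] and third in [C] has mass
    [nu (cell i) * Q i C], which is the [g2]-mass of their product. *)
Lemma glued_approximation n : exists G : probability S3 R,
  (forall A, measurable A -> G (fst @^-1` A) = g1 A) /\
  (forall O, measurable O -> saturated n O ->
    G [set t | O (t.1.2, t.2)] = g2 O).
Proof.
have mc := cell_measurable b_open n.
have /choice[Q QE] := fun i => conditional_law (mc i).
have mD i : measurable (setT `*` cell b n i : set (borel E * borel E)%type).
  exact: measurableX.
have mD' i : measurable (cell b n i `*` setT : set (borel E * borel E)%type).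
  exact: measurableX.
pose M i : {measure set S3 -> \bar R} := (mrestr g1 (mD i) \x Q i)%E.
(* Only finitely many cells are nonempty; summing over all codes spares a bound on them. *)
pose M0 : {measure set S3 -> \bar R} := mseries M 0.
have ME i A C : measurable A -> measurable C ->
    M i (A `*` C) = (g1 (A `&` (setT `*` cell b n i)) * Q i C)%E.
  by move=> mA mC; rewrite /M [LHS]product_measure1E.
have split_cell (g : probability (borel E * borel E)%type R)
    (D : nat -> set (borel E * borel E)%type) A :
    (forall i, measurable (D i)) -> trivIset setT D -> \bigcup_i D i = setT ->
    measurable A -> g A = (\sum_(i <oo) g (A `&` D i))%E.
  move=> mDD tD UD mA; rewrite -[in LHS](setIT A) -UD setI_bigcupr.
  have mAD i : measurable (A `&` D i) by exact: measurableI.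
  rewrite measure_semi_bigcup//; first exact: trivIset_setIl.
  exact: bigcup_measurable.
have M0E A : M0 A = (\sum_(i <oo) M i A)%E by [].
have M0fst A : measurable A -> M0 (fst @^-1` A) = g1 A.
  move=> mA; rewrite M0E.
  rewrite (split_cell g1 (fun i => setT `*` cell b n i) A)//; last 2 first.
  - apply/trivIsetP => i j _ _ /eqP ij; apply/seteqP; split => // z.
    by move=> [[_ /= zi] [_ /= zj]]; apply: ij; rewrite -zi.
  - by apply/seteqP; split => // z _; exists (cell_code b n z.2).
  apply: eq_eseriesr => i _.
  rewrite (_ : _ @^-1` A = A `*` setT); last first.
    by apply/seteqP; split => z //= [].
  by rewrite ME// [X in (_ * X)%E]probability_setT mule1.
have M01 : M0 setT = 1%E.
  rewrite -[setT](preimage_setT (@fst (borel E * borel E) (borel E))) M0fst//.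
  exact: probability_setT.
have [G GE] := pushforward_probability (@measurable_id _ S3 setT) M01.
exists G; split => [A mA|O mO sO]; rewrite GE /pushforward preimage_id.
  exact: M0fst.
rewrite M0E (split_cell g2 (fun i => cell b n i `*` setT) O)//; last 2 first.
- apply/trivIsetP => i j _ _ /eqP ij; apply/seteqP; split => // z.
  by move=> [[/= zi _] [/= zj _]]; apply: ij; rewrite -zi.
- by apply/seteqP; split => // z _; exists (cell_code b n z.1).
apply: eq_eseriesr => i _.
(* By saturation, all points of the cell have the same section of [O], so over the cell [O] is a
   rectangle. *)
pose C := [set z | exists y, cell b n i y /\ O (y, z)] : set (borel E).
have mC : measurable C.
  have [[y yi]|/forallNP nc] := pselect (exists y, cell b n i y); last first.
    rewrite (_ : C = set0)//; apply/seteqP; split => // z [y [yi _]].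
    exact: nc yi.
  rewrite (_ : C = xsection O y); first exact: measurable_xsection.
  apply/seteqP; split => z; rewrite /xsection /= inE.
    by move=> [y' [yi' Oy']]; apply: sO Oy'; rewrite yi' yi.
  by move=> Oy; exists y.
have OC : O `&` (cell b n i `*` setT) = cell b n i `*` C.
  apply/seteqP; split => -[y z] /=.
    by move=> [Oyz [yi _]]; split => //; exists y.
  by move=> [yi [y' [yi' Oy']]]; split => //; apply: sO Oy'; rewrite yi' yi.
rewrite OC QE//; pose SO := [set t : S3 | O (t.1.2, t.2)].
have mSO : measurable SO.
  have mp : measurable_fun setT (fun t : S3 => (t.1.2, t.2)).
    apply: measurable_fun_pair; last exact: measurable_snd.
    by apply: measurableT_comp; [exact: measurable_snd|exact: measurable_fst].
  by have := mp measurableT O mO; rewrite setTI.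
have mDT : measurable ((setT `*` cell b n i) `*` setT : set S3).
  exact: measurableX.
apply: etrans (measureDI (M i) mSO mDT) _.
(* [M i] charges only triples whose middle point is in cell [i]. *)
have M0D : M i (SO `\` ((setT `*` cell b n i) `*` setT)) = 0%E.
  apply/eqP; rewrite eq_le measure_ge0 andbT.
  apply: (@le_trans _ _ (M i ((~` (setT `*` cell b n i)) `*` setT))).
    rewrite le_measure ?inE//; first exact: measurableD.
      by apply: measurableX => //; exact: measurableC.
    by move=> t [_ nt]; split => // ?; apply: nt.
  rewrite ME//; last exact: measurableC.
  by rewrite setICl measure0 mul0e.
rewrite [X in (X + _)%E]M0D add0e.
rewrite (_ : SO `&` _ = (setT `*` cell b n i) `*` C); last first.
  apply/seteqP; split => -[[x y] z] /=.
    by move=> [Oyz [[_ yi] _]]; split => //; exists y.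
  move=> [[_ yi] [y' [yi' Oy']]]; split => //; apply: sO Oy'.
  by rewrite yi' yi.
by rewrite [LHS]ME// setIid; congr (_ * _)%E; exact: (g1_cpl (mc i)).2.
Qed.

End gluing.

(** * The triangle inequality for [W] *)

Section triangle_inequality.
Context (R : realType) (E : ptopologicalType).
Hypotheses (E_lc : locally_compact [set: E]) (E_hausdorff : hausdorff_space E).
Hypotheses (E_sc : @second_countable E) (E_polish : polish R E).
Implicit Types (mu nu rho : probability (borel E) R) (m : E -> E -> R).

Let E_regular : regular_space E := locally_compact_regular E_hausdorff E_lc.
Let S3 := ((borel E * borel E) * borel E)%type.
Let T3 := ((E * E) * E)%type.

Lemma open_prod3_measurable (G : set T3) : open G -> measurable (G : set S3).
Proof.
have [b bb] := second_countable_enum E_sc.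
move=> oG; apply: (@enum_basis_measurable _ _ _ S3 id
  (prod_enum_basis (prod_enum_basis bb bb) bb) _ G oG) => n.
apply: measurableX; last by apply: sub_sigma_algebra; exact: bb.1.
by apply: measurableX; apply: sub_sigma_algebra; exact: bb.1.
Qed.

(* The glued approximations converge to a law on [E^3] whose marginals are
   only known to be dominated on open sets, which is enough for the
   integrals of a lower semicontinuous cost. *)
Lemma W_triangle m mu nu rho : pseudometrics m ->
  W m mu rho <= W m mu nu + W m nu rho.
Proof.
move=> pm; have um := pseudometrics_unit_lsc pm.
have mtri : forall x y z, m x z <= m x y + m y z by case: pm.
have Watt := W_attained E_lc E_hausdorff E_sc E_polish.
have [g1 c1 <-] := Watt _ mu nu um.
have [g2 c2 <-] := Watt _ nu rho um.
have [b [ob nb]] := second_countable_enum E_sc.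
have /choice[G GP] := glued_approximation c1 c2 ob.
have mK (K : set E) : compact K -> measurable (K : set (borel E)).
  by move=> cK; apply: borel_closed_measurable; exact: compact_closed.
have G1 n (A : set (borel E)) : measurable A ->
    G n [set t | A t.1.1] = mu A.
  move=> mA; rewrite -(c1 A mA).1.
  rewrite -[RHS](GP n).1; last exact: measurableX.
  by congr (G n _); apply/seteqP; split => t //= [].
have G2 n (A : set (borel E)) : measurable A ->
    G n [set t | A t.1.2] = nu A.
  move=> mA; rewrite -(c1 A mA).2.
  rewrite -[RHS](GP n).1; last exact: measurableX.
  by congr (G n _); apply/seteqP; split => t //= [].
have G3 n (A : set (borel E)) : measurable A ->
    G n [set t | A t.2] = rho A.
  move=> mA; rewrite -(c2 A mA).2.
  rewrite -[RHS](GP n).2; last 2 first.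
  - exact: measurableX.
  - by move=> y y' z _ [].
  by congr (G n _); apply/seteqP; split => t //= [].
have tight1 (la : probability (borel E) R) (e : R) : 0 < e ->
    exists2 K, compact K & 1 - e <= fine (la K).
  (* A single law is tight, as the weak limit of a constant sequence. *)
  move=> e0; have [K cK Ke] := weak_cvg_tight E_lc E_sc E_polish
    (@weak_cvg_cst _ _ la) e0.
  by exists K => //; have [n _ /(_ n (leqnn n))] := Ke.
have [|P Plim] := @prokhorov R T3 _ S3 id G
  (hausdorff_prod (hausdorff_prod E_hausdorff E_hausdorff) E_hausdorff)
  (regular_prod (regular_prod E_regular E_regular) E_regular)
  open_prod3_measurable.
  move=> e e0; have e30 : 0 < e / 3 by rewrite divr_gt0.
  have [K cK Ke] := tight1 mu _ e30.
  have [L cL Le] := tight1 nu _ e30.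
  have [M cM Me] := tight1 rho _ e30.
  exists ((K `*` L) `*` M); first by apply: compact_setX => //; exact: compact_setX.
  apply: nearW => n; rewrite preimage_id.
  have [mKK mLL mMM] := And3 (mK _ cK) (mK _ cL) (mK _ cM).
  have mA1 : measurable ((K `*` setT) `*` setT : set S3).
    by apply: measurableX => //; exact: measurableX.
  have mA2 : measurable ((setT `*` L) `*` setT : set S3).
    by apply: measurableX => //; exact: measurableX.
  have mA3 : measurable (setT `*` M : set S3) by exact: measurableX.
  have E1 : G n ((K `*` setT) `*` setT) = mu K.
    apply: etrans (G1 n K mKK); congr (G n _).
    by apply/seteqP; split => t //= [[]].
  have E2 : G n ((setT `*` L) `*` setT) = nu L.
    apply: etrans (G2 n L mLL); congr (G n _).
    by apply/seteqP; split => t //= [[]].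
  have E3 : G n (setT `*` M) = rho M.
    apply: etrans (G3 n M mMM); congr (G n _).
    by apply/seteqP; split => t //= [].
  have I1 := probability_setI_ge (G n) mA1 mA2.
  have I2 := probability_setI_ge (G n) (measurableI _ _ mA1 mA2) mA3.
  rewrite E1 E2 in I1; rewrite E3 -!setXI !setTI !setIT in I2.
  rewrite -!setXI !setTI !setIT in I1.
  apply: le_trans I2; lra.
have cfst : continuous (fst \o fst : T3 -> E).
  by move=> x; apply: continuous_comp; exact: cvg_fst.
have cmid : continuous (snd \o fst : T3 -> E).
  by move=> x; apply: continuous_comp; [exact: cvg_fst|exact: cvg_snd].
have csnd : continuous (snd : T3 -> E) by move=> x; exact: cvg_snd.
have m13 := borel_prod_measurable cfst csnd.
have m12 := borel_prod_measurable cfst cmid.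
have m23 := borel_prod_measurable cmid csnd.
have [g gE] := pushforward_probability m13 (probability_setT P).
(* The law of the outer two coordinates is a coupling of [mu] and [rho], so its cost bounds the
   left-hand side. *)
have cg : coupling mu rho g.
  move=> A mA; rewrite gE /pushforward; split.
  - apply: etrans (limit_marginal E_polish Plim cfst _ _ (@weak_cvg_cst _ _ mu) mA).
    + by congr (P _); apply/seteqP; split => z //= [].
    + exact: measurableT_comp measurable_fst measurable_fst.
    + by move=> n B mB; rewrite -(G1 n B mB).
  - apply: etrans (limit_marginal E_polish Plim csnd _ _ (@weak_cvg_cst _ _ rho) mA).
    + by congr (P _); apply/seteqP; split => z //= [].
    + exact: measurable_snd.
    + by move=> n B mB; rewrite -(G3 n B mB).
have mm := unit_lsc_measurable E_sc um.
have mle0 z : 0 <= m z.1 z.2 by case/andP: (um.1 z.1 z.2).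
apply: (le_trans (W_le E_sc um cg)).
rewrite (Rintegral_pushforward m13 (mu := P))//=; last by move=> A mA; rewrite gE.
have [lm01 lm] := um.
have if12 : P.-integrable setT (EFin \o (fun t => m t.1.1 t.1.2)).
  by apply: unit_integrable => //; exact: measurableT_comp mm m12.
have if23 : P.-integrable setT (EFin \o (fun t => m t.1.2 t.2)).
  by apply: unit_integrable => //; exact: measurableT_comp mm m23.
have if13 : P.-integrable setT (EFin \o (fun t => m t.1.1 t.2)).
  by apply: unit_integrable => //; exact: measurableT_comp mm m13.
have cpair : continuous (fun t : T3 => (t.1.2, t.2)).
  by move=> t; apply: cvg_pair; [exact: cmid|exact: csnd].
(* Every [G n] has [g1] as its law of the first two coordinates, so the bound passes directly to the
   limit. *)
have P12 : \int[P]_t m t.1.1 t.1.2 <= \int[g1]_z m z.1 z.2.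
  apply: (Plim (fun t : T3 => m t.1.1 t.1.2)) => //.
    have cfst' : continuous (@fst (E * E) E) by move=> t; exact: cvg_fst.
    exact: lsc_comp cfst' lm.
  apply: nearW => n; rewrite (Rintegral_pushforward
    (@measurable_fst _ _ (borel E * borel E)%type (borel E)) (Q := g1) (mu := G n))//.
  by move=> A mA; exact: esym ((GP n).1 A mA).
(* Exhaust [H] by finite unions [O N] of basic boxes. For [N] fixed and [n] large, [O N] is
   saturated, so [G n] gives it its [g2]-mass, at most [g2 H]. Let [n], then [N], tend to
   infinity. *)
have P23open (H : set (E * E)) : open H ->
    fine (P [set t | H (t.1.2, t.2)]) <= fine (g2 H).
  move=> oH; have mH := open_prod_measurable E_sc oH.
  have bb := prod_enum_basis (conj ob nb) (conj ob nb).
  pose c := prod_enum b b; pose D k := if `[< c k `<=` H >] then c k else set0.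
  have oD k : open (D k) by rewrite /D; case: ifP => _; [exact: bb.1|exact: open0].
  have DH k : D k `<=` H.
    by rewrite /D; case: asboolP => // _; exact: sub0set.
  pose O N := \big[setU/set0]_(k < N) D k.
  have oO N : open (O N).
    by apply: (big_ind (@open _)); [exact: open0|exact: openU|move=> k _].
  have OH N : O N `<=` H.
    by rewrite /O -(bigcup_mkord N D) => z [k _ /DH].
  pose F N := [set t : T3 | O N (t.1.2, t.2)].
  have oF N : open (F N) by move/continuousP: cpair; apply.
  have mF N : measurable (F N : set (borel T3)) by exact: sub_sigma_algebra.
  have UF : \bigcup_N F N = [set t | H (t.1.2, t.2)].
    apply/seteqP; split => [t [N _ /OH//]|t Ht].
    have [k ck ckH] := bb.2 _ H (open_nbhs_nbhs (conj oH Ht)).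
    exists k.+1 => //; rewrite /F /= /O big_ord_recr/=; right.
    by rewrite /D asboolT.
  have mUF : measurable (\bigcup_N F N : set (borel T3)).
    exact: bigcup_measurable.
  have Fcvg : P (F N) @[N --> \oo] --> P (\bigcup_N F N).
    apply: nondecreasing_cvg_mu => // i j ij; apply/subsetPset => t.
    exact: subset_bigsetU.
  move: Fcvg; rewrite -[P (\bigcup_N F N)]fineK ?fin_num_measure// UF.
  move=> /fine_cvgP[_] /cvgr_to_le; apply; apply: nearW => N /=.
  rewrite -Rintegral_indic//; apply: (Plim (\1_(F N))) => //.
  - by move=> t; rewrite indicE ler0n lern1 leq_b1.
  - exact: indic_lsc.
  near=> n; have mF3 : measurable (F N : set S3) by exact: open_prod3_measurable.
  have mON := open_prod_measurable E_sc (oO N).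
  rewrite Rintegral_indic// fine_le ?fin_num_measure//.
  apply: (@le_trans _ _ (g2 (O N))); last by rewrite le_measure ?inE.
  rewrite le_eqVlt; apply/orP; left; apply/eqP; apply: (GP n).2 => //.
  move=> y y' z e; rewrite /O -(bigcup_mkord N D) => -[k /= kN].
  rewrite /D; case: asboolP => // ckH [/= cy cz]; exists k => //.
  rewrite asboolT//; split => //=; apply: (cell_code_mem e) cy.
  (* [p k] is the index of the first factor of the box [c k]; saturation of [O N] needs [n] above
     all of these for [k < N]. *)
  pose p k := (odflt (0, 0)%N (unpickle k : option (nat * nat))).1.
  have kN' : (p k <= \max_(k < N) p k)%N by exact: (leq_bigmax (Ordinal kN)).
  apply: leq_ltn_trans kN' _; near: n; exact: nbhs_infty_gt.
have P23 : \int[P]_t m t.1.2 t.2 <= \int[g2]_z m z.1 z.2.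
  apply: layer_cake_compare => //; first exact: measurableT_comp mm m23.
  by move=> a; apply: P23open; exact: lsc_superlevel_open a lm.
rewrite (le_trans _ (lerD P12 P23))// -RintegralD//; apply: le_Rintegral => //.
exact: (integrableD measurableT if12 if23).
Unshelve. all: by end_near. Qed.

End triangle_inequality.

(** * The functional [Fc] and its least fixpoint *)

Section behavioural_functional.
Context (R : realType) (E : ptopologicalType).
Hypotheses (E_lc : locally_compact [set: E]) (E_hausdorff : hausdorff_space E).
Hypotheses (E_sc : @second_countable E) (E_polish : polish R E).
Variables (X : ctmp R E) (c : R).
Hypotheses (c_gt0 : 0 < c) (c_lt1 : c < 1).
Implicit Types (m : E -> E -> R).

(** Kernel values are bare measures; normalising them, which changes nothing at mass one, makes them
    probabilities to which the results on [W] apply. *)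
Definition transition_prob (t : R) (x : E) : probability (borel E) R :=
  mnormalize (transition X t x) (dirac point).

Lemma transition_probE t x A : transition_prob t x A = transition X t x A.
Proof.
rewrite /transition_prob /= /mnormalize prob_kernel onee_eq0/= invr1.
by rewrite mule1.
Qed.

Lemma W_transition_prob m t x y :
  W m (transition X t x) (transition X t y) =
  W m (transition_prob t x) (transition_prob t y).
Proof.
rewrite /W; congr (inf [set _ | _ in _]).
apply/seteqP; split => g cg A mA; have [g1 g2] := cg A mA.
  by split; [apply: etrans g1 _|apply: etrans g2 _];
    exact/esym/transition_probE.
by split; [apply: etrans g1 _|apply: etrans g2 _]; exact: transition_probE.
Qed.

Lemma Rintegral_transition_prob t x (f : E -> R) :
  \int[transition_prob t x]_y f y = \int[transition X t x]_y f y.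
Proof.
congr fine; apply: eq_measure_integral => A mA _; exact: transition_probE.
Qed.

Lemma transition_prob_weak_cvg t (u : nat -> E) x : 0 <= t ->
  u @ \oo --> x ->
  weak_cvg (fun n => transition_prob t (u n)) (transition_prob t x).
Proof.
move=> t0 ux f cf bf; rewrite Rintegral_transition_prob.
under eq_fun do rewrite Rintegral_transition_prob.
exact: transition_weak_cont.
Qed.

(** This is how [P_0 x] is known to be the Dirac mass at [x]: the identity semigroup at time 0 is
    tested on functions of [C0] below the indicator of [U] with values at [x] close to 1. *)
Lemma transition_prob0_open x (U : set E) : open U -> U x ->
  fine (transition_prob 0 x U) = 1.
Proof.
move=> oU Ux; have mU : measurable (U : set (borel E)) by exact: sub_sigma_algebra.
apply/eqP; rewrite eq_le.
have /andP[_ ->] := fine_probability01 (transition_prob 0 x) mU.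
rewrite /=; apply/ler_addgt0Pr => e e0; rewrite -lerBlDr.
have [V Vx cV] := locally_compact_nbhs E_lc x.
(* Shrinking [U] into a relatively compact neighbourhood makes the approximants vanish off a compact
   set, hence belong to [C0]. *)
have oUV : open (U `&` V°) by apply: openI => //; exact: open_interior.
have mUV : measurable (U `&` V° : set (borel E)) by exact: sub_sigma_algebra.
have [phi [cphi phi01 phi_le phi_cvg]] := polish_open_indic_approx E_polish oUV.
have [k xk] : exists k, 1 - e < phi k x.
  have := phi_cvg x; rewrite indicE mem_set//.
  have e1 : 1 - e < 1 by rewrite ltrBlDr ltrDl.
  by move=> /(cvgr_gt _)/(_ _ e1)[k _ kP]; exists k; exact: kP (leqnn k).
have phiC0 : C0 (phi k).
  split => // r r0; exists (closure V) => // z nVz.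
  have phi0 : phi k z = 0.
    have /andP[p0 _] := phi01 k z; apply/eqP; rewrite eq_le p0 andbT.
    rewrite (le_trans (phi_le k z))// indicE memNset// => -[_ Vz]; apply: nVz.
    exact: subset_closure (interior_subset Vz).
  by rewrite phi0 normr0.
rewrite (le_trans (ltW xk))// -(@semigroup0 _ _ X _ phiC0).
rewrite transitionE// -Rintegral_transition_prob.
apply: (@le_trans _ _ (fine (transition_prob 0 x (U `&` V°)))); last first.
  by rewrite fine_le ?fin_num_measure// le_measure ?inE.
rewrite -Rintegral_indic//; apply: le_Rintegral => //.
- by apply: unit_integrable => //; exact: continuous_borel_measurable.
- exact: indic_integrable.
Qed.

Let W_attained := W_attained E_lc E_hausdorff E_sc E_polish.

(** Any coupling of the two laws gives full mass to every open box around [(x, y)], and by lower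
    semicontinuity [m] exceeds [m x y - e] on a small one. *)
Lemma W_transition0_ge m x y : unit_lsc m ->
  m x y <= W m (transition_prob 0 x) (transition_prob 0 y).
Proof.
move=> um; have [g cg <-] := W_attained (transition_prob 0 x)
  (transition_prob 0 y) um.
apply/ler_addgt0Pr => e e0; rewrite -lerBlDr; set a := m x y - e.
have [V [[A B] /= [Ax By] ABV] Va] : exists2 V, nbhs (x, y) V &
    forall z : E * E, V z -> a < m z.1 z.2.
  by have [|V nV VP] := um.2 (x, y) a; [rewrite /= lte_fin /a ltrBlDr ltrDl|exists V].
have oA := @open_interior _ A; have oB := @open_interior _ B.
have mA : measurable (A° : set (borel E)) by exact: sub_sigma_algebra.
have mB : measurable (B° : set (borel E)) by exact: sub_sigma_algebra.
have mAT : measurable (A° `*` setT : set (borel E * borel E)%type).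
  exact: measurableX.
have mTB : measurable (setT `*` B° : set (borel E * borel E)%type).
  exact: measurableX.
have mAB : measurable (A° `*` B° : set (borel E * borel E)%type).
  exact: measurableX.
have gAB : fine (g (A° `*` B°)) = 1.
  have /andP[_ g1] := fine_probability01 g mAB.
  apply/eqP; rewrite eq_le g1/=.
  have := probability_setI_ge g mAT mTB; rewrite (cg _ mA).1 (cg _ mB).2.
  by rewrite !transition_prob0_open// -setXI setTI setIT addrK.
have [a0|a0] := leP a 0.
  by rewrite (le_trans a0)//; case/andP: (unit_lsc_Rintegral E_sc g um).
have -> : a = \int[g]_z (a * \1_(A° `*` B°) z).
  rewrite RintegralZl//; last exact: indic_integrable.
  by rewrite Rintegral_indic// gAB mulr1.
apply: le_Rintegral => //; last 2 first.
- exact: unit_lsc_integrable.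
- move=> z _; rewrite indicE; case: (boolP (z \in _)) => [|_].
    rewrite inE => -[Az Bz]; rewrite mulr1 ltW//; apply: Va; apply: ABV.
    by split; exact: interior_subset.
  by rewrite mulr0; case/andP: (um.1 z.1 z.2).
exact: (integrableZl measurableT a (indic_integrable g mAB)).
Qed.

(** [E] is metrizable, so a failure would yield points converging to [(x, y)] at which [W] stays at
    most [b], against [W_lsc_seq]. *)
Lemma W_transition_lsc m t x y b : 0 <= t -> unit_lsc m ->
  b < W m (transition_prob t x) (transition_prob t y) ->
  exists2 V, nbhs (x, y) V & forall z : E * E, V z ->
    b < W m (transition_prob t z.1) (transition_prob t z.2).
Proof.
move=> t0 um bW; apply: contrapT => nV.
have [[d [[d_ge0 d_eq0] d_sym d_triangle d_nbhs _]] _] := E_polish.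
have inv0 n : 0 < n.+1%:R^-1 :> R by rewrite invr_gt0.
have /choice[z zP] : forall n, exists z : E * E,
    [/\ d x z.1 < n.+1%:R^-1, d y z.2 < n.+1%:R^-1 &
       W m (transition_prob t z.1) (transition_prob t z.2) <= b].
  move=> n; apply: contrapT => nz; apply: nV.
  exists ([set u | d x u < n.+1%:R^-1] `*` [set v | d y v < n.+1%:R^-1]).
    exists ([set u | d x u < n.+1%:R^-1], [set v | d y v < n.+1%:R^-1]) => //=.
    by split; apply/d_nbhs; exists n.+1%:R^-1.
  move=> z [/= z1 z2]; rewrite ltNge; apply/negP => Wz; apply: nz.
  by exists z.
have cvgd (w : E) (u : nat -> E) : (forall n, d w (u n) < n.+1%:R^-1) ->
    u @ \oo --> w.
  move=> du A /d_nbhs[e e0 eA].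
  have [N _ NP] := near_infty_natSinv_lt (PosNum e0).
  by exists N => // n Nn; apply: eA; exact: lt_trans (du n) (NP n Nn).
suff : W m (transition_prob t x) (transition_prob t y) <= b.
  by rewrite leNgt bW.
apply: (W_lsc_seq E_lc E_hausdorff E_sc E_polish um
  (mu_ := fun n => transition_prob t (z n).1)
  (nu_ := fun n => transition_prob t (z n).2)).
- by apply: transition_prob_weak_cvg => //; apply: cvgd => n; case: (zP n).
- by apply: transition_prob_weak_cvg => //; apply: cvgd => n; case: (zP n).
- by move=> n; case: (zP n).
Qed.

Lemma discount01 t : 0 <= t -> 0 < c `^ t <= 1.
Proof.
move=> t0; rewrite powR_gt0//= -(powRr0 c); apply: ger_powR => //.
by rewrite c_gt0 ltW.
Qed.

Lemma Fc_le m x y a :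
  (forall t, 0 <= t ->
    c `^ t * W m (transition_prob t x) (transition_prob t y) <= a) ->
  Fc X c m x y <= a.
Proof.
move=> h; apply: ge_sup; first by eexists; exists 0 => /=.
by move=> _ [t /= t0 <-]; rewrite W_transition_prob; exact: h.
Qed.

Lemma Fc_ge m x y t : unit_lsc m -> 0 <= t ->
  c `^ t * W m (transition_prob t x) (transition_prob t y) <= Fc X c m x y.
Proof.
move=> um t0; apply: ub_le_sup; last by exists t => //; rewrite W_transition_prob.
exists 1 => _ [s /= s0 <-]; rewrite W_transition_prob.
have /andP[w0 w1] := W01 E_lc E_hausdorff E_sc E_polish
  (transition_prob s x) (transition_prob s y) um.
have /andP[c0 c1] := discount01 s0.
by rewrite mulr_ile1// ltW.
Qed.

Lemma le_Fc m m' x y : unit_lsc m -> unit_lsc m' ->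
  (forall u v, m u v <= m' u v) -> Fc X c m x y <= Fc X c m' x y.
Proof.
move=> um um' mm'; apply: Fc_le => t t0; apply: le_trans (Fc_ge x y um' t0).
have /andP[c0 _] := discount01 t0; rewrite ler_pM2l//.
exact: (le_W E_lc E_hausdorff E_sc E_polish).
Qed.

(** The term at time 0, where the discount is 1, already dominates [m]. *)
Lemma Fc_increases m x y : unit_lsc m -> m x y <= Fc X c m x y.
Proof.
move=> um; apply: le_trans (Fc_ge x y um (lexx 0)).
by rewrite powRr0 mul1r; exact: W_transition0_ge.
Qed.

Lemma Fc_pseudometrics m : pseudometrics m -> pseudometrics (Fc X c m).
Proof.
move=> pm; have um := pseudometrics_unit_lsc pm.
have [_ m0 msym mtri _] := pm.
split.
- move=> x y; apply/andP; split.
    apply: le_trans (Fc_increases x y um); by case/andP: (um.1 x y).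
  apply: Fc_le => t t0; have /andP[c0 c1] := discount01 t0.
  have /andP[w0 w1] := W01 E_lc E_hausdorff E_sc E_polish
    (transition_prob t x) (transition_prob t y) um.
  by rewrite mulr_ile1// ltW.
- move=> x; apply/eqP; rewrite eq_le; apply/andP; split.
    apply: Fc_le => t t0.
    by rewrite (W_refl E_lc E_hausdorff E_sc E_polish)// mulr0.
  by rewrite -[leLHS](m0 x) Fc_increases.
- move=> x y; apply/eqP; rewrite eq_le; apply/andP; split.
    apply: Fc_le => t t0; rewrite (W_sym E_lc E_hausdorff E_sc E_polish)//.
    exact: Fc_ge.
  apply: Fc_le => t t0; rewrite (W_sym E_lc E_hausdorff E_sc E_polish)//.
  exact: Fc_ge.
- move=> x y z; apply: Fc_le => t t0; have /andP[c0 _] := discount01 t0.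
  apply: le_trans (lerD (Fc_ge x y um t0) (Fc_ge y z um t0)).
  rewrite -mulrDr ler_pM2l//.
  exact: (W_triangle E_lc E_hausdorff E_sc E_polish).
- move=> [x y] a /=; rewrite lte_fin => aF.
  (* A supremum above [a] has a term above [a], and the neighbourhood for that term works for the
     supremum. *)
  have [t [t0 at_]] : exists t, 0 <= t /\
      a < c `^ t * W m (transition_prob t x) (transition_prob t y).
    apply: contrapT => nt; move: aF; apply/negP; rewrite -leNgt.
    by apply: Fc_le => t t0; rewrite leNgt; apply/negP => h; apply: nt; exists t.
  have /andP[c0 _] := discount01 t0.
  move: at_; rewrite -ltr_pdivrMl// => /(W_transition_lsc t0 um)[V nV VP].
  exists V => // z /VP; rewrite ltr_pdivrMl// lte_fin => /lt_le_trans; apply.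
  exact: Fc_ge.
Qed.

Lemma delta0_pseudometrics : pseudometrics (delta0 X).
Proof.
split.
- move=> x y; rewrite normr_ge0/= ler_norml.
  have /andP[x0 x1] := obs_bound X x; have /andP[y0 y1] := obs_bound X y; lra.
- by move=> x; rewrite /delta0 subrr normr0.
- by move=> x y; rewrite /delta0 distrC.
- by move=> x y z; exact: ler_distD.
- apply: (@continuous_lsc _ _ (fun z : E * E => `|obs X z.1 - obs X z.2|)).
  move=> z; apply: cvg_norm; apply: cvgB.
  + by apply: continuous_comp; [exact: cvg_fst|exact: obs_cont].
  + by apply: continuous_comp; [exact: cvg_snd|exact: obs_cont].
Qed.

Lemma delta_pseudometrics n : pseudometrics (delta X c n).
Proof.
elim: n => [|n IH]; first exact: delta0_pseudometrics.
exact: Fc_pseudometrics.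
Qed.

Lemma delta_unit_lsc n : unit_lsc (delta X c n).
Proof. exact/pseudometrics_unit_lsc/delta_pseudometrics. Qed.

Lemma delta_nondecreasing n k x y : (n <= k)%N ->
  delta X c n x y <= delta X c k x y.
Proof.
move=> /subnK <-; elim: (k - n)%N => // j IH; rewrite addSn.
apply: (le_trans IH); exact/Fc_increases/delta_unit_lsc.
Qed.

Lemma delta_le_bar n x y : delta X c n x y <= delta_bar X c x y.
Proof.
apply: ub_le_sup; last by exists n.
by exists 1 => _ [k _ <-]; case/andP: ((delta_unit_lsc k).1 x y).
Qed.

Lemma delta_bar_le x y a : (forall n, delta X c n x y <= a) ->
  delta_bar X c x y <= a.
Proof.
move=> h; apply: ge_sup; first by eexists; exists 0%N.
by move=> _ [n _ <-].
Qed.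

Lemma delta_cvg x y : delta X c n x y @[n --> \oo] --> delta_bar X c x y.
Proof.
apply: nondecreasing_cvgn; first by move=> n k; exact: delta_nondecreasing.
by exists 1 => _ [k _ <-]; case/andP: ((delta_unit_lsc k).1 x y).
Qed.

Lemma delta_bar_pseudometrics : pseudometrics (delta_bar X c).
Proof.
have P n := delta_pseudometrics n; split.
- move=> x y; apply/andP; split.
    apply: le_trans (delta_le_bar 0 x y).
    by case/andP: ((delta_unit_lsc 0).1 x y).
  by apply: delta_bar_le => n; case/andP: ((delta_unit_lsc n).1 x y).
- move=> x; apply/eqP; rewrite eq_le; apply/andP; split.
    by apply: delta_bar_le => n; have [_ ->] := P n.
  by apply: le_trans (delta_le_bar 0 x x); have [_ ->] := P 0%N.
- move=> x y; apply/eqP; rewrite eq_le; apply/andP; split.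
    by apply: delta_bar_le => n; have [_ _ -> _ _] := P n; exact: delta_le_bar.
  by apply: delta_bar_le => n; have [_ _ -> _ _] := P n; exact: delta_le_bar.
- move=> x y z; apply: delta_bar_le => n; have [_ _ _ tri _] := P n.
  by apply: (le_trans (tri x y z)); apply: lerD; exact: delta_le_bar.
- move=> [x y] a /=; rewrite lte_fin => aF.
  have [n an] : exists n, a < delta X c n x y.
    apply: contrapT => nt; move: aF; apply/negP; rewrite -leNgt.
    by apply: delta_bar_le => n; rewrite leNgt; apply/negP => h; apply: nt; exists n.
  have [V nV VP] := (delta_unit_lsc n).2 (x, y) a an.
  exists V => // z /VP /lt_le_trans; apply; rewrite lee_fin.
  exact: delta_le_bar.
Qed.

(** For each [t] the discounted [W] of [delta X c n] is at most [delta X c n.+1], hence at most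
    [delta_bar]. [W_sup_le] carries this bound to the supremum; the converse is [Fc_increases]. *)
Lemma Fc_delta_bar : Fc X c (delta_bar X c) = delta_bar X c.
Proof.
have ub := pseudometrics_unit_lsc delta_bar_pseudometrics.
apply/funext => x; apply/funext => y; apply/eqP; rewrite eq_le.
rewrite Fc_increases// andbT; apply: Fc_le => t t0.
have /andP[c0 _] := discount01 t0; rewrite -ler_pdivlMl//.
apply: (W_sup_le E_lc E_hausdorff E_sc E_polish delta_unit_lsc ub).
- exact: delta_nondecreasing.
- exact: delta_cvg.
- move=> n; rewrite ler_pdivlMl//; apply: le_trans (delta_le_bar n.+1 x y).
  exact/Fc_ge/t0/delta_unit_lsc.
Qed.

(** Monotonicity of [Fc] keeps each iterate below the fixpoint [m]. *)
Lemma delta_le_fixpoint m n x y : pseudometrics m -> Fc X c m = m ->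
  (forall u v, `|obs X u - obs X v| <= m u v) -> delta X c n x y <= m x y.
Proof.
move=> pm Fm dm; elim: n x y => [|n IH] x y; first exact: dm.
rewrite -Fm; apply: le_Fc => //; first exact: delta_unit_lsc.
exact: pseudometrics_unit_lsc.
Qed.

End behavioural_functional.

Theorem theorem2 (R : realType) (E : ptopologicalType)
    (E_lc : locally_compact [set: E]) (E_hausdorff : hausdorff_space E)
    (E_countable_base : @second_countable E) (E_polish : polish R E)
    (X : ctmp R E) (c : R) (c_gt0 : 0 < c) (c_lt1 : c < 1) :
  [/\ pseudometrics (delta_bar X c),
      Fc X c (delta_bar X c) = delta_bar X c,
      (forall x y : E, `|obs X x - obs X y| <= delta_bar X c x y) &
      (forall m : E -> E -> R, pseudometrics m -> Fc X c m = m ->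
        (forall x y : E, `|obs X x - obs X y| <= m x y) ->
        forall x y : E, delta_bar X c x y <= m x y)].
Proof.
split.
- exact: delta_bar_pseudometrics.
- exact: Fc_delta_bar.
- move=> x y; rewrite -[leLHS]/(delta X c 0 x y).
  exact: (delta_le_bar E_lc E_hausdorff E_countable_base E_polish).
- move=> m pm Fm dm x y; apply: delta_bar_le => n.
  exact: (delta_le_fixpoint E_lc E_hausdorff E_countable_base E_polish).
Qed.
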